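(* Let $p\in(0,1)$ and let $\Lambda,V$ satisfy Assumption A (see context). With $(\mathbf X_{\Lambda,p},\mathbf Y_{\Lambda,p},\pi^*_{\Lambda,p})$ and $Q_K^0$ as defined in the context, $Q_K^0$ converges in $\mathbb P_{\Lambda,p}$-probability, in TV, to a unique limit $\mathsf Q\in\mathcal P(\{\varnothing\}\cup\mathbf Y_{\Lambda,p})$ as $K\to\infty$; i.e. there is a ($\mathbb P_{\Lambda,p}$-a.s. unique) random probability vector $\mathsf Q$ such that for any $\epsilon>0$, $$\lim_{K\to\infty}\mathbb P_{\Lambda,p}\big[\mathrm{TV}(\mathsf Q,Q_K^0)\ge\epsilon\big]=0.$$
   Context: Assumption A (dimension $d=1$). (i) $\Lambda$ is a continuous probability density on $[0,1]$ with $0<\Lambda_{\min}\le\Lambda(x)\le\Lambda_{\max}$ for all $x\in[0,1]$. (ii) $V:\mathbb R\to\mathbb R$ satisfies $V(\varepsilon)=V(-\varepsilon)$, $\int_{\mathbb R}e^{-V(\varepsilon)}\,d\varepsilon=1$, and there are constants $C_0,c_0,\delta>0$, $V_{\min}\in\mathbb R$ and non-decreasing $f,g:[0,\infty)\to\mathbb R$ with $C_0(1+|\varepsilon|^{C_0})\ge g(|\varepsilon|)\ge V(\varepsilon)-V_{\min}\ge f(|\varepsilon|)\ge c_0|\varepsilon|^{1+\delta}$ for all $\varepsilon\in\mathbb R$. Write $q(\varepsilon)=e^{-V(\varepsilon)}$. $\mathcal P(S)$ is the set of probability distributions on a countable set $S$, $\mathrm{TV}(P,P')=\frac12\sum_j|P(j)-P'(j)|$,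 and $\mathrm{PPP}(\mu)$ is the homogeneous Poisson point process on $\mathbb R$ of rate $\mu$. Point processes. Construct $(\mathbf X_{\Lambda,p},\mathbf Y_{\Lambda,p},\pi^*_{\Lambda,p})$ by: 1. sample $x\sim\Lambda$; 2. given $x$, set $\mathbf X_{\Lambda,p}=\{0\}\cup\widetilde{\mathbf X}$ with $\widetilde{\mathbf X}\sim\mathrm{PPP}(\Lambda(x)p/(1-p)^2)$; 3. include each $\mathsf X\in\mathbf X_{\Lambda,p}$ in $\mathrm{dom}(\pi^*_{\Lambda,p})$ independently with probability $p$; 4. for each $\mathsf X\in\mathrm{dom}(\pi^*_{\Lambda,p})$ independently sample $\varepsilon\sim q$ and set $\pi^*_{\Lambda,p}(\mathsf X)=\mathsf X+\varepsilon$; let $\mathrm{range}(\pi^*_{\Lambda,p})$ be the set of these values; 5. independently sample $\bar{\mathbf Y}\sim\mathrm{PPP}(\Lambda(x)p/(1-p))$ and set $\mathbf Y_{\Lambda,p}=\bar{\mathbf Y}\cup\mathrm{range}(\pi^*_{\Lambda,p})$. $\mathbb P_{\Lambda,p}$ denotes the law of this construction. Local Gibbs measures. A partial bijection $\pi$ from a set $S$ to a set $T$ is a bijection from a subset of $S$ to a subset of $T$; write $\pi(s)=\varnothing$ if $s$ is not in its domain and $\pi^{-1}(t)=\varnothing$ if $t$ is not in its range. For $K>0$ let $\mathbf X_K=\mathbf X_{\Lambda,p}\cap[-K,K]$, $\mathbf Y_K=\mathbf Y_{\Lambda,p}\cap[-K,K]$, and let $Q_K$ be the probability measure on partial bijections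 $\pi$ from $\mathbf X_K$ to $\mathbf Y_K$ given by $$Q_K(\pi)\propto\exp\Big(-\sum_{\mathsf X\in\mathbf X_K:\pi(\mathsf X)\ne\varnothing}V(\mathsf X-\pi(\mathsf X))+\sum_{\mathsf X\in\mathbf X_K:\pi(\mathsf X)=\varnothing}U+\sum_{\mathsf Y\in\mathbf Y_K:\pi^{-1}(\mathsf Y)=\varnothing}U\Big),\quad U=\log\sqrt{\Lambda(x)},$$ with $x$ the point sampled in step 1. Let $Q^0_K(\mathsf Y)=Q_K(\pi(0)=\mathsf Y)$ for $\mathsf Y\in\{\varnothing\}\cup\mathbf Y_K$, extended by $0$ to $\{\varnothing\}\cup\mathbf Y_{\Lambda,p}$. *)

(* Defs.v *)
From HB Require Import structures.
From mathcomp Require Import all_boot all_order all_algebra finmap.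
From mathcomp Require Import all_classical all_reals all_analysis.
From mathcomp Require Import measurable_realfun.

Set Implicit Arguments.
Unset Strict Implicit.
Unset Printing Implicit Defensive.

Import Order.TTheory GRing.Theory Num.Theory.
Import numFieldNormedType.Exports.

Local Open Scope classical_set_scope.
Local Open Scope ring_scope.

Definition density_assumption (R : realType) (Lam : R -> R) : Prop :=
  [/\ {within `[0, 1], continuous Lam},
      (\int[lebesgue_measure]_(x in `[0%R, 1%R]) (Lam x)%:E = 1)%E &
      exists Lmin Lmax : R, 0 < Lmin /\
        forall x, x \in `[0, 1] -> Lmin <= Lam x <= Lmax].

(* Measurability of V is implicit in the existence of the integral of exp(-V);
   it has to be required here because the library's integral is also defined
   for non-measurable functions. *)
Definition potential_assumption (R : realType) (V : R -> R) : Prop :=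
  [/\ measurable_fun setT V,
      (forall e, V e = V (- e)),
      (\int[lebesgue_measure]_e (expR (- V e))%:E = 1)%E &
      exists (C0 c0 delta Vmin : R) (f g : R -> R),
        [/\ [/\ 0 < C0, 0 < c0 & 0 < delta],
            {in `[0, +oo[ &, {homo f : s t / s <= t}},
            {in `[0, +oo[ &, {homo g : s t / s <= t}} &
            forall e : R,
              [/\ g `|e| <= C0 * (1 + `|e| `^ C0),
                  V e - Vmin <= g `|e|,
                  f `|e| <= V e - Vmin &
                  c0 * (`|e| `^ (1 + delta)) <= f `|e|]]].

(* A distribution on a set S of elements of J is represented by its mass
   function extended by 0 to J. *)
Definition is_pmf (R : realType) (J : choiceType) (S : set J) (Q : J -> R) :
    Prop :=
  [/\ forall j, 0 <= Q j,
      forall j, ~ S j -> Q j = 0 &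
      (\esum_(j in S) (Q j)%:E = 1)%E].

Definition TV (R : realType) (J : choiceType) (S : set J) (Q Q' : J -> R) :
    \bar R :=
  ((2^-1)%:E * \esum_(j in S) `|Q j - Q' j|%:E)%E.

Section Probability.
Context {R : realType} {d : measure_display} {Om : measurableType d}.
Implicit Types mu : set Om -> \bar R.

Definition mutually_independent mu (I : choiceType) (G : I -> set_system Om) :
    Prop :=
  forall (J : {fset I}) (E : I -> set Om),
    (forall i, i \in J -> G i (E i)) ->
    mu (\bigcap_(i in [set` J]) E i) = (\prod_(i <- J) mu (E i))%E.

Definition sigma_of d' (T : measurableType d') (f : Om -> T) : set_system Om :=
  preimage_set_system setT f measurable.

Definition sigma_of_seq d' (T : measurableType d') (f : nat -> Om -> T) :
    set_system Om :=
  <<s \bigcup_n sigma_of (f n) >>.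

(* Homogeneous Poisson point process of the given rate, as a random set of
   reals: the numbers of points in disjoint Borel sets of finite Lebesgue
   measure are independent Poisson variables.  The second argument of
   [poisson_prob] is a dummy; at rate 0, [poisson_prob] is the Dirac mass at 0
   (whereas [poisson_pmf] is then constantly 1). *)
Definition is_PPP mu (rate : R) (X : Om -> set R) : Prop :=
  forall (n : nat) (B : 'I_n -> set R) (k : 'I_n -> nat),
    (forall i, measurable (B i)) ->
    (forall i, (lebesgue_measure (B i) < +oo)%E) ->
    (forall i j, i != j -> B i `&` B j = set0) ->
    let E := [set w | forall i, (X w `&` B i #= `I_(k i))%card] in
    measurable E /\
    mu E = (\prod_(i < n)
       poisson_prob (rate * fine (lebesgue_measure (B i))) (k i) [set k i])%E.

(* A random element of P({None} u Y), i.e. a random probability measure on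
   [option R] carried by {None} u Y; measurability is that of the masses of
   Borel sets. *)
Definition with_empty (Y : set R) : set (option R) := None |` (Some @` Y).

Definition random_pmf (Y : Om -> set R) (Q : Om -> option R -> R) : Prop :=
  [/\ forall w, is_pmf (with_empty (Y w)) (Q w),
      measurable_fun setT (fun w => Q w None) &
      forall B : set R, measurable B ->
        measurable_fun setT
          (fun w => \esum_(y in B) (Q w (Some y))%:E)%E].

(* The events below are measurable as soon as Y is enumerated by random
   variables and Q, Q_K K are measurable as in [random_pmf]. *)
Definition cvg_TV_in_probability (P : probability Om R) (Y : Om -> set R)
    (QK : R -> Om -> option R -> R) (Q : Om -> option R -> R) : Prop :=
  forall eps : R, 0 < eps ->
    P [set w | (eps%:E <= TV (with_empty (Y w)) (Q w) (QK K w))%E]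
      @[K --> +oo] --> 0%E.

End Probability.

(* The countable random sets are enumerated without repetition: [xi] lists the
   points of the process X~ and [eta] those of Ybar.  X is listed by
   [Xpt 0 = 0] and [Xpt n.+1 = xi n]; [b n] says whether [Xpt n] belongs to
   the domain of pi*, in which case its image is [Xpt n + e n] (the variables
   [e n] with [b n = false] are not used). *)
Section Construction.
Context {R : realType} {d : measure_display} {Om : measurableType d}.
Variables (p : R) (Lam V : R -> R).
Variables (x : {mfun Om >-> R}) (xi eta : nat -> {mfun Om >-> R}).
Variables (b : nat -> {mfun Om >-> bool}) (e : nat -> {mfun Om >-> R}).

Definition Xpt (n : nat) (w : Om) : R := if n is m.+1 then xi m w else 0.

Definition Xset (w : Om) : set R := range (Xpt ^~ w).

Definition pistar_range (w : Om) : set R :=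
  [set Xpt n w + e n w | n in [set n | b n w]].

Definition Yset (w : Om) : set R := range (eta ^~ w) `|` pistar_range w.

Definition sources (i : bool + (nat + nat)) : set_system Om :=
  match i with
  | inl true => sigma_of_seq (fun n => xi n : Om -> R)
  | inl false => sigma_of_seq (fun n => eta n : Om -> R)
  | inr (inl n) => sigma_of (b n)
  | inr (inr n) => sigma_of (e n)
  end.

Definition conditional_construction (mu : set Om -> \bar R) (l : R) : Prop :=
  [/\ is_PPP mu (l * p / (1 - p) ^+ 2) (fun w => range (xi ^~ w)),
      forall n, mu (b n @^-1` [set true]) = p%:E,
      forall n (A : set R), measurable A ->
        mu (e n @^-1` A) =
          (\int[lebesgue_measure]_(t in A) (expR (- V t))%:E)%E,
      is_PPP mu (l * p / (1 - p)) (fun w => range (eta ^~ w)) &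
      mutually_independent mu sources].

(* [kappa u] is the conditional law given x = u. *)
Definition is_construction (P : probability Om R) : Prop :=
  [/\ forall w, x w \in `[0, 1],
      forall w, injective (xi ^~ w),
      forall w, injective (eta ^~ w) &
      exists kappa : R.-pker R ~> Om,
        [/\ forall E, measurable E ->
              P E = (\int[lebesgue_measure]_(u in `[0%R, 1%R])
                       (kappa u E * (Lam u)%:E))%E,
            forall u, u \in `[0, 1] -> kappa u [set w | x w = u] = 1%E &
            forall u, u \in `[0, 1] ->
              conditional_construction (kappa u) (Lam u)]].

End Construction.

Section Gibbs.
Context {R : realType}.
Variables (V : R -> R) (U : R) (S T : {fset R}).
Implicit Types pi : {ffun S -> option T}.

Definition partial_bijection pi : bool :=
  [forall s, forall s', (pi s != None) && (pi s == pi s') ==> (s == s')].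

Definition gibbs_weight pi : R :=
  expR (- (\sum_(s | pi s != None) oapp (fun t => V (val s - val t)) 0 (pi s))
        + \sum_(s | pi s == None) U
        + \sum_(t | [forall s, pi s != Some t]) U).

Definition gibbs pi : R :=
  gibbs_weight pi / \sum_(pi' | partial_bijection pi') gibbs_weight pi'.

Definition pb_apply pi (s : R) : option R :=
  obind (fun s' : S => omap val (pi s')) (insub s).

Definition gibbs_at0 (y : option R) : R :=
  \sum_(pi | partial_bijection pi && (pb_apply pi 0 == y)) gibbs pi.

End Gibbs.

Definition window {R : realType} (K : R) (A : set R) : {fset R} :=
  fset_set (A `&` `[- K, K]).

(* The law Q_K^0, extended by 0; X_K and Y_K are almost surely finite, which is
   what makes [window] meaningful. *)
Definition QK0 {R : realType} {d : measure_display} {Om : measurableType d}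
    (Lam V : R -> R) (x : Om -> R) (X Y : Om -> set R) (K : R) (w : Om) :
    option R -> R :=
  gibbs_at0 V (ln (Num.sqrt (Lam (x w)))) (window K (X w)) (window K (Y w)).

(* Main.v *)
Require Import Defs.
From HB Require Import structures.
From mathcomp Require Import all_boot all_order all_algebra finmap.
From mathcomp Require Import all_classical all_reals all_analysis.
From mathcomp Require Import measurable_realfun.
From mathcomp Require Import ring lra zify.
Import Order.TTheory GRing.Theory Num.Theory.
Import numFieldNormedType.Exports.
Local Open Scope ring_scope.

(** Up to a constant factor, the Gibbs weight of a partial matching is the product of
    the weights [exp (- V (x - y)) / Lam] of its edges.  For such a hard-core measure, deleting
    edges shows that an edge [a] is present with probability at most its weight [w a], and that
    no edge of a set [A] is present with probability at least [prod_(a in A) (1 + w a)^-1],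
    even conditionally on edges outside [A].

    Take increasing intervals [[- t_k, t_k]].  If, in two independent samples from the measures
    of two large windows, no edge crosses the boundary of the k-th interval, then swapping the
    parts inside that interval preserves the product measure and exchanges the two partners
    of [0].  Hence the two laws of the partner of [0] are at total variation distance at most
    twice the probability that every boundary is crossed.  That probability is small when there
    are many boundaries, the weights crossing each of them have a bounded sum, and edges jumping
    over two consecutive boundaries have small weights.

    The weight of an edge [(x, y)] is at most [C exp (- |x - y|)], so with
    [peak t y = exp (- | |y| - t |)] the crossing weights at [t] are bounded by products of the sums
    of [peak t] over the two point sets.  These sums have expectation bounded uniformly in [t],
    so by Fatou they almost surely stay bounded along a sequence of [t]; the boundaries are
    chosen along that sequence, and the window measures almost surely form a Cauchy family. *)

(** * Hard-core measures on finite edge sets *)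

(** A single boundary need only stay uncrossed with probability bounded below. The edges that cross
    the k-th boundary and no other form disjoint classes, so avoiding one class costs at most a
    factor [B] whatever happens at the others, and all [n] classes are met with probability at most
    [(1 - B^-1) ^+ n]. Edges over two boundaries belong to no class and are paid for by a union
    bound. The constants can be chosen because [B = expR (4 * C * M ^+ 2)] depends on neither [n]
    nor the gaps: first [n], then the gap that beats the [n] jump terms, and only then the
    boundaries. The swap is legitimate because an edge inside the interval lies in both windows,
    while any other edge has both ends outside and shares no endpoint with it; an edge at [0] is
    always inside. The moment estimates bound an expectation at each [t], not a supremum over [t];
    hence the random sequence of boundaries. Since [M] and the boundaries depend on the outcome, the
    limit is built outcome by outcome, and its measurability is inherited from the window
    measures. *)

Section HardCore.
Context {R : realFieldType} {E : finType} (w : E -> R).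
Hypothesis w_ge0 : forall e, 0 <= w e.

Definition wt (M : {set E}) : R := \prod_(e in M) w e.

Lemma wt_ge0 M : 0 <= wt M.
Proof. exact: prodr_ge0. Qed.

Lemma ler_sum_sub (I : finType) (P Q : pred I) (f : I -> R) :
  (forall i, 0 <= f i) -> (forall i, P i -> Q i) ->
  \sum_(i | P i) f i <= \sum_(i | Q i) f i.
Proof.
move=> f0 PQ; rewrite big_mkcond [leRHS]big_mkcond /=; apply: ler_sum => i _.
by case: ifP => [/PQ ->|_] //; case: ifP.
Qed.

(** Removing [e] is injective on the sets containing it, stays in [H], and costs exactly the factor
    [w e]. *)
Lemma wt_mem_le (H : pred {set E}) e :
  (forall M, H M -> H (M :\ e)) ->
  \sum_(M | H M && (e \in M)) wt M <= w e * \sum_(M | H M && (e \notin M)) wt M.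
Proof.
move=> He.
rewrite (reindex_onto (fun N => e |: N) (fun M => M :\ e)); last first.
  by move=> M /andP[_ eM]; rewrite finset.setD1K.
rewrite mulr_sumr.
rewrite [leRHS](eq_bigr (fun M => w e * wt M)) // -mulr_sumr.
rewrite (eq_bigr (fun M => w e * wt M)); last first.
  move=> N /andP[_ /eqP eN].
  by rewrite /wt big_setU1 // -eN !inE eqxx.
rewrite -mulr_sumr; apply: ler_wpM2l => //.
apply: ler_sum_sub => [M|N]; first exact: wt_ge0.
move=> /andP[/andP[HN _] /eqP eN]; rewrite -eN He //=.
by rewrite !inE eqxx.
Qed.

(** By [wt_mem_le], forbidding one more edge costs at most a factor [1 + w e]. The event [H] may
    require edges outside [s] to be present; this is what makes the bound conditional. *)
Lemma wt_avoid_le (H : pred {set E}) (s : seq E) :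
  (forall M e, e \in s -> H M -> H (M :\ e)) ->
  \sum_(M | H M) wt M <=
  (\prod_(e <- s) (1 + w e)) * \sum_(M | H M && all [pred e | e \notin M] s) wt M.
Proof.
elim: s => [|e s IH] Hs /=.
  by rewrite big_nil mul1r; under [leRHS]eq_bigl do rewrite andbT.
have /le_trans : \sum_(M | H M) wt M <= (\prod_(e <- s) (1 + w e)) *
    \sum_(M | H M && all [pred e | e \notin M] s) wt M.
  by apply: IH => M f fs; apply: Hs; rewrite inE fs orbT.
apply; rewrite big_cons [(1 + w e) * _]mulrC -mulrA.
apply: ler_wpM2l; first by apply: prodr_ge0 => i _; rewrite addr_ge0.
rewrite (bigID (fun M : {set E} => e \in M)) /= mulrDl mul1r addrC.
have -> : \sum_(M | H M && ((e \notin M) && all (fun e0 => e0 \notin M) s)) wt M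
  = \sum_(M | H M && all (fun e0 => e0 \notin M) s && (e \notin M)) wt M.
  by apply: eq_bigl => M; rewrite -andbA [X in _ && X]andbC.
rewrite lerD2l; apply: wt_mem_le => M /andP[HM aM].
rewrite Hs ?inE ?eqxx//=; apply/allP => f fs /=.
by have fM : f \notin M := allP aM f fs; rewrite inE negb_and fM orbT.
Qed.

(** The event that the first [n] classes are met is stable under deleting edges of the next class,
    because the classes are disjoint. Conditionally on it, the next class is therefore missed with
    probability at least [B^-1]. *)
Lemma wt_meet_le (F : pred {set E}) (n : nat) (C : nat -> pred E) (B : R) :
  1 <= B ->
  (forall M e, F M -> F (M :\ e)) ->
  (forall i j e, C i e -> C j e -> i = j) ->
  (forall k, (k < n)%N -> \prod_(e | C k e) (1 + w e) <= B) ->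
  \sum_(M | F M && [forall k : 'I_n, exists e in M, C k e]) wt M
    <= (1 - B^-1) ^+ n * \sum_(M | F M) wt M.
Proof.
move=> B1 FD Cd; have B0 : 0 < B by apply: lt_le_trans B1.
elim: n => [|n IH] CB.
  rewrite expr0 mul1r; apply: ler_sum_sub => [M|M /andP[]//]; exact: wt_ge0.
set H := fun M => F M && [forall k : 'I_n, exists e in M, C k e].
have -> : \sum_(M | F M && [forall k : 'I_n.+1, exists e in M, C k e]) wt M
    = \sum_(M | H M) wt M
      - \sum_(M | H M && ~~ [exists e in M, C n e]) wt M.
  rewrite (bigID (fun M : {set E} => [exists e in M, C n e]) H) /= addrK.
  apply: eq_bigl => M; rewrite /H -andbA; congr (_ && _).
  apply/forallP/andP => [h|[/forallP h hn] k].
    split; last by have := h ord_max.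
    by apply/forallP => k; have := h (widen_ord (leqnSn n) k).
  have [kn|] := ltnP k n; first by have := h (Ordinal kn).
  move=> nk; have -> // : (k : nat) = n.
  by apply/eqP; rewrite eqn_leq nk -ltnS ltn_ord.
have IH' : \sum_(M | H M) wt M <= (1 - B^-1) ^+ n * \sum_(M | F M) wt M.
  by apply: IH => k kn; apply: CB; rewrite ltnS ltnW.
rewrite exprS -mulrA.
apply: (@le_trans _ _ ((1 - B^-1) * \sum_(M | H M) wt M)); last first.
  by apply: ler_wpM2l => //; rewrite subr_ge0 invf_le1.
rewrite mulrBl mul1r lerD2l lerN2 -(ler_pM2l B0) mulrA mulfV ?gt_eqF // mul1r.
have Hd M e : e \in enum (C n) -> H M -> H (M :\ e).
  rewrite mem_enum => Ce /andP[FM /forallP h]; apply/andP; split.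
    exact: FD.
  apply/forallP => k; have /existsP[f /andP[fM Cf]] := h k.
  apply/existsP; exists f; rewrite Cf andbT inE fM andbT inE.
  apply: contraTneq (ltn_ord k) => fe.
  by rewrite -leqNgt (Cd k n e) // -fe.
have /le_trans := wt_avoid_le H (enum (C n)) Hd; apply.
apply: ler_pM.
- by apply: prodr_ge0 => i _; rewrite addr_ge0.
- by apply: sumr_ge0 => M _; exact: wt_ge0.
- by rewrite big_enum /=; apply: CB.
- apply: ler_sum_sub => [M|M /andP[-> /allP a] /=]; first exact: wt_ge0.
  rewrite negb_exists; apply/forallP => f; apply/negP => /andP[fM Cf].
  by have /= := a f; rewrite mem_enum fM => /(_ Cf).
Qed.

Lemma wt_exists_le (F : pred {set E}) (J : pred E) :
  (forall M e, F M -> F (M :\ e)) ->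
  \sum_(M | F M && [exists e in M, J e]) wt M
    <= (\sum_(e | J e) w e) * \sum_(M | F M) wt M.
Proof.
move=> FD; rewrite mulr_suml.
apply: (@le_trans _ _ (\sum_(e | J e) \sum_(M | F M && (e \in M)) wt M)).
  rewrite (exchange_big_dep F) /= => [|e M _ /andP[]//].
  rewrite big_mkcondr /=; apply: ler_sum => M FM.
  case: ifP => [/existsP[e /andP[eM Je]]|_]; last first.
    by apply: sumr_ge0 => i _; exact: wt_ge0.
  rewrite (bigD1 e) /=; last by rewrite Je FM eM.
  by rewrite lerDl; apply: sumr_ge0 => i _; exact: wt_ge0.
apply: ler_sum => e Je; apply: le_trans (wt_mem_le F e _) _ => [M|]; first exact: FD.
apply: ler_wpM2l => //; apply: ler_sum_sub => [M|M /andP[]//]; exact: wt_ge0.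
Qed.

End HardCore.

(* A pair of edge sets is encoded as one set of edges labelled by a boolean, so that the
   bounds of the previous section apply to pairs. *)
Section Doubling.
Context {R : realFieldType} {E : finType} (w : E -> R).
Hypothesis w_ge0 : forall e, 0 <= w e.

Definition layer (M : {set bool * E}) (c : bool) : {set E} :=
  [set e | (c, e) \in M].

Definition both (F1 F2 : pred {set E}) (M : {set bool * E}) : bool :=
  F1 (layer M false) && F2 (layer M true).

Lemma both_D1 (F1 F2 : pred {set E}) :
  (forall M e, F1 M -> F1 (M :\ e)) -> (forall M e, F2 M -> F2 (M :\ e)) ->
  forall M x, both F1 F2 M -> both F1 F2 (M :\ x).
Proof.
move=> D1 D2 M [c e] /andP[h1 h2].
have same : layer (M :\ (c, e)) c = layer M c :\ e.
  by apply/setP => f; rewrite !inE xpair_eqE eqxx.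
have other : layer (M :\ (c, e)) (~~ c) = layer M (~~ c).
  by apply/setP => f; rewrite !inE xpair_eqE; case: (c).
case: c same other => same other; rewrite /both.
  by rewrite same [layer _ false]other h1 D2.
by rewrite same [layer _ true]other h2 D1.
Qed.

(** Pairs of edge sets correspond bijectively to labelled edge sets, and the weight [w \o snd]
    ignores labels. *)
Lemma sum_both (F1 F2 : pred {set E}) (g1 g2 : {set E} -> R) :
  (\sum_(M | F1 M) wt w M * g1 M) * (\sum_(M | F2 M) wt w M * g2 M) =
  \sum_(M | both F1 F2 M)
    wt (w \o snd) M * (g1 (layer M false) * g2 (layer M true)).
Proof.
rewrite big_distrlr /= pair_big /=.
pose h (MM : {set E} * {set E}) : {set bool * E} :=
  [set x | x.2 \in if x.1 then MM.2 else MM.1].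
pose k (M : {set bool * E}) := (layer M false, layer M true).
have kh MM : k (h MM) = MM.
  by case: MM => M1 M2; congr pair; apply/setP => e; rewrite !inE.
have hk M : h (k M) = M by apply/setP => -[[] e]; rewrite !inE.
rewrite [RHS](reindex h) /=; last by exists k => M _.
apply: eq_big => [MM|MM _]; first by rewrite -{1 2}(kh MM) /=.
have := kh MM; rewrite /k; case: MM => M1 M2 [-> ->] /=.
rewrite mulrACA; congr (_ * _); rewrite /wt.
rewrite big_mkcond [X in _ * X]big_mkcond /= [RHS]big_mkcond /=.
rewrite (eq_bigr (fun x => (fun c e => if e \in (if c then M2 else M1) then w e else 1) x.1 x.2));
  last by case=> c e _ /=; rewrite inE.
by rewrite -(pair_bigA _ (fun c e => if e \in (if c then M2 else M1) then w e else 1)) /=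
  big_bool /= mulrC.
Qed.

Context {T : eqType} (F1 F2 : pred {set E}) (lo hi : E -> nat) (n : nat)
  (phi : {set E} -> T).

(** [lo] and [hi] stand for the levels of the inner and outer endpoints, kept abstract here: a
    crossing edge has one end within level [k] and the other beyond. The label plays no part, so
    flips preserve crossings. *)
Definition crosses (k : nat) (x : bool * E) : bool := (lo x.2 <= k < hi x.2)%N.
Definition uncrossed (k : nat) (M : {set bool * E}) : bool :=
  [forall x in M, ~~ crosses k x].
(* Exchanges the two copies of the edges that lie within level [k]. *)
Definition flip (k : nat) (x : bool * E) : bool * E :=
  (if (hi x.2 <= k)%N then ~~ x.1 else x.1, x.2).

Lemma flipK k : involutive (flip k).
Proof. by case=> c e; rewrite /flip /=; case: leqP; rewrite ?negbK. Qed.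

Lemma mem_flip k (M : {set bool * E}) x : (x \in flip k @: M) = (flip k x \in M).
Proof.
apply/imsetP/idP => [[y yM ->]|xM]; first by rewrite flipK.
by exists (flip k x); rewrite ?flipK.
Qed.

Lemma flip_setK k : involutive (fun M : {set bool * E} => flip k @: M).
Proof. by move=> M; apply/setP => x; rewrite !mem_flip flipK. Qed.

Lemma wt_flip k (M : {set bool * E}) : wt (w \o snd) (flip k @: M) = wt (w \o snd) M.
Proof. by rewrite /wt big_imset //= => x y _ _; exact: (inv_inj (flipK k)). Qed.

Lemma uncrossed_flip j k (M : {set bool * E}) : uncrossed j (flip k @: M) = uncrossed j M.
Proof.
apply/forall_inP/forall_inP => h x xM.
  by have := h (flip k x); rewrite mem_flip flipK => /(_ xM).
by rewrite mem_flip in xM; exact: (h _ xM).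
Qed.

Hypothesis F1D : forall M e, F1 M -> F1 (M :\ e).
Hypothesis F2D : forall M e, F2 M -> F2 (M :\ e).
Hypothesis F_flip : forall k (M : {set bool * E}), (k < n)%N -> both F1 F2 M -> uncrossed k M ->
  both F1 F2 (flip k @: M).
Hypothesis phi_flip : forall k (M : {set bool * E}) c, (k < n)%N -> both F1 F2 M -> uncrossed k M ->
  phi (layer (flip k @: M) c) = phi (layer M (~~ c)).

Let D (y : T) (M : {set bool * E}) : R :=
  (phi (layer M false) == y)%:R - (phi (layer M true) == y)%:R.

Let bad j (M : {set bool * E}) := both F1 F2 M && [forall k : 'I_n, (k < j)%N ==> ~~ uncrossed k M].

(* The summand is antisymmetric under [flip j], which preserves weights and every event
   [uncrossed k]. *)
Lemma swap_cancel y j : (j <= n)%N ->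
  \sum_(M | both F1 F2 M) wt (w \o snd) M * D y M =
  \sum_(M | bad j M) wt (w \o snd) M * D y M.
Proof.
elim: j => [|j IH] jn.
  apply: eq_bigl => M; rewrite /bad; case: both => //=.
  by apply/esym/forallP => k.
rewrite IH ?(ltnW jn)// (bigID (fun M => uncrossed j M)) /=.
rewrite [X in X + _ = _](_ : _ = 0) ?add0r; last first.
  set S := LHS.
  suff : S = - S by move=> /eqP; rewrite -subr_eq0 opprK -mulr2n mulrn_eq0 => /eqP.
  rewrite {1}/S (reindex_inj (inv_inj (flip_setK j))) /= -sumrN.
  apply: eq_big => M.
    rewrite uncrossed_flip /bad; have [uj|] := boolP (uncrossed j M); last by rewrite !andbF.
    rewrite !andbT; under eq_forallb do rewrite uncrossed_flip.
    congr (_ && _); apply/idP/idP => h; last exact: F_flip.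
    by rewrite -(flip_setK j M); apply: F_flip => //; rewrite uncrossed_flip.
  rewrite uncrossed_flip /bad => /andP[/andP[h _] uj].
  have bM : both F1 F2 M.
    by rewrite -(flip_setK j M); apply: F_flip => //; rewrite uncrossed_flip.
  by rewrite wt_flip /D !phi_flip //= -mulrN opprB.
apply: eq_bigl => M; rewrite /bad -andbA; congr (_ && _).
apply/andP/forallP => [[/forallP h uj] k|h].
  apply/implyP; rewrite ltnS leq_eqVlt => /orP[/eqP -> //|kj].
  by have := h k; rewrite kj.
split; last by have := h (Ordinal jn); rewrite /= ltnSn.
by apply/forallP => k; apply/implyP => kj; have := h k; rewrite ltnS ltnW.
Qed.

(** Each of the two copies takes a single value of [phi], which occurs at most once in [L]. *)
Lemma sum_diff_le (L : seq T) M : uniq L -> \sum_(y <- L) `|D y M| <= 2.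
Proof.
move=> uL; pose u c := \sum_(y <- L) (phi (layer M c) == y)%:R : R.
have u1 c : u c <= 1.
  rewrite /u; have [yL|yL] := boolP (phi (layer M c) \in L).
    rewrite (bigD1_seq (phi (layer M c))) //= eqxx big1 ?addr0// => y yn.
    by rewrite eq_sym (negbTE yn).
  rewrite big1_seq ?ler01// => y /andP[_ yy].
  by case: eqP => // h; rewrite h yy in yL.
apply: (@le_trans _ _ (u false + u true)); last by rewrite (natrD _ 1 1) lerD.
rewrite /u -big_split /=; apply: ler_sum => y _.
by rewrite /D; apply: le_trans (ler_normB _ _) _; rewrite !ger0_norm.
Qed.

Definition ratio (F : pred {set E}) (y : T) : R :=
  (\sum_(M | F M && (phi M == y)) wt w M) / \sum_(M | F M) wt w M.

Lemma partition_gt0 (F : pred {set E}) : F finset.set0 -> 0 < \sum_(M | F M) wt w M.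
Proof.
move=> F0; rewrite (bigD1 finset.set0) //= {1}/wt big_set0.
by apply: ltr_wpDr => //; apply: sumr_ge0 => M _; exact: wt_ge0.
Qed.

(** After cancellation only pairs with every level crossed remain. Then either some edge jumps over
    two levels, or each level [k] is crossed by an edge of its own class [lo = k], [hi = k.+1].
    Having two copies of each edge produces the square in the hypothesis and the inner factor 2; the
    outer one is [sum_diff_le]. *)
Lemma tv_bound (B : R) (L : seq T) :
  F1 finset.set0 -> F2 finset.set0 -> 1 <= B -> uniq L ->
  (forall k, (k < n)%N ->
    (\prod_(e | (lo e == k) && (hi e == k.+1)) (1 + w e)) ^+ 2 <= B) ->
  \sum_(y <- L) `|ratio F1 y - ratio F2 y| <=
  2 * (2 * (\sum_(e | ((lo e).+1 < hi e)%N) w e) + (1 - B^-1) ^+ n).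
Proof.
move=> F10 F20 B1 uL CB.
set Z1 := \sum_(M | F1 M) wt w M; set Z2 := \sum_(M | F2 M) wt w M.
have Z10 : 0 < Z1 by exact: partition_gt0.
have Z20 : 0 < Z2 by exact: partition_gt0.
pose W (M : {set bool * E}) := wt (w \o snd) M.
have w0' (x : bool * E) : 0 <= (w \o snd) x by exact: w_ge0.
have W0 M : 0 <= W M by exact: wt_ge0.
have ZE : Z1 * Z2 = \sum_(M | both F1 F2 M) W M.
  have one (F : pred {set E}) : \sum_(M | F M) wt w M = \sum_(M | F M) wt w M * 1.
    by apply: eq_bigr => M _; rewrite mulr1.
  by rewrite /Z1 /Z2 !one sum_both; apply: eq_bigr => M _; rewrite !mulr1.
have dE y : ratio F1 y - ratio F2 y =
    (\sum_(M | bad n M) W M * D y M) / (Z1 * Z2).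
  rewrite -swap_cancel // /D; under eq_bigr do rewrite mulrBr.
  rewrite sumrB.
  have indic (F Q : pred {set E}) :
      \sum_(M | F M && Q M) wt w M = \sum_(M | F M) wt w M * (Q M)%:R.
    by rewrite big_mkcondr; apply: eq_bigr => M _; case: (Q M); rewrite ?mulr1 ?mulr0.
  have one (F : pred {set E}) : \sum_(M | F M) wt w M = \sum_(M | F M) wt w M * 1.
    by apply: eq_bigr => M _; rewrite mulr1.
  have -> : \sum_(M | both F1 F2 M) W M * (phi (layer M false) == y)%:R
     = (\sum_(M | F1 M && (phi M == y)) wt w M) * Z2.
    rewrite indic /Z2 one sum_both; apply: eq_bigr => M _; by rewrite mulr1.
  have -> : \sum_(M | both F1 F2 M) W M * (phi (layer M true) == y)%:R
     = Z1 * (\sum_(M | F2 M && (phi M == y)) wt w M).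
    rewrite indic /Z1 one sum_both; apply: eq_bigr => M _; by rewrite mul1r.
  rewrite /ratio -/Z1 -/Z2; field.
  by rewrite !gt_eqF.
have badE : \sum_(M | bad n M) W M <=
    (2 * (\sum_(e | ((lo e).+1 < hi e)%N) w e) + (1 - B^-1) ^+ n) * (Z1 * Z2).
  pose J (x : bool * E) := ((lo x.2).+1 < hi x.2)%N.
  pose C k (x : bool * E) := (lo x.2 == k) && (hi x.2 == k.+1).
  rewrite mulrDl; have -> : 2 * \sum_(e | ((lo e).+1 < hi e)%N) w e
     = \sum_(x | J x) (w \o snd) x.
    have <- := pair_big xpredT (fun e => ((lo e).+1 < hi e)%N) (fun (c : bool) e => w e).
    by rewrite big_bool /= mulrDl mul1r.
  have Fb := both_D1 F1 F2 F1D F2D.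
  have hJ := wt_exists_le (w \o snd) w0' (both F1 F2) J Fb.
  have hC : \sum_(M | both F1 F2 M && [forall k : 'I_n, exists x in M, C k x]) W M
      <= (1 - B^-1) ^+ n * \sum_(M | both F1 F2 M) W M.
    apply: wt_meet_le => //.
    - by move=> i j x /andP[/eqP <- _] /andP[/eqP ->].
    - move=> k kn; apply: le_trans (CB k kn).
      have <- := pair_big xpredT (fun e => (lo e == k) && (hi e == k.+1))
        (fun (c : bool) e => 1 + w e).
      by rewrite big_bool /= expr2.
  rewrite ZE; apply: le_trans (lerD hJ hC).
  have mk (Q : pred {set bool * E}) : \sum_(M | both F1 F2 M && Q M) W M
      = \sum_(M | both F1 F2 M) (if Q M then W M else 0) by exact: big_mkcondr.
  rewrite /bad !mk -big_split /=; apply: ler_sum => M FM.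
  case: ifP => [/forallP h|_]; last by rewrite addr_ge0 //; case: ifP.
  case: ifP => [_|/negbT/existsPn noJ]; first by rewrite lerDl; case: ifP.
  rewrite add0r ifT //; apply/forallP => k.
  have := h k; rewrite ltn_ord /= => /forall_inPn[x xM]; rewrite negbK => cx.
  apply/existsP; exists x; rewrite xM /=.
  by have := noJ x; rewrite xM /J /C /=; move: cx; rewrite /crosses; lia.
apply: (@le_trans _ _ ((\sum_(M | bad n M) 2 * W M) / (Z1 * Z2))).
  under eq_bigr do rewrite dE normrM normfV (ger0_norm (mulr_ge0 (ltW Z10) (ltW Z20))).
  rewrite -mulr_suml; apply: ler_wpM2r; first by rewrite invr_ge0 mulr_ge0 // ltW.
  apply: (@le_trans _ _ (\sum_(y <- L) \sum_(M | bad n M) W M * `|D y M|)).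
    apply: ler_sum => y _; apply: le_trans (ler_norm_sum _ _ _) _.
    by apply: ler_sum => M _; rewrite normrM ger0_norm.
  rewrite exchange_big /=; apply: ler_sum => M _.
  by rewrite -mulr_sumr mulrC ler_wpM2r // sum_diff_le.
rewrite -mulr_sumr -mulrA; apply: ler_wpM2l => //.
by rewrite ler_pdivrMr // mulr_gt0.
Qed.

End Doubling.

(** * Partial matchings *)

Section Matching.
Context {R : realType} (V : R -> R) (U : R) {A B : finType} (f : A -> R) (g : B -> R).

(** The factor gained by adding an edge: two points cease to be unmatched, so [U] is lost twice. For
    [U = ln (Num.sqrt Lam)] this is [expR (- V (x - y)) / Lam]. *)
Definition edge_weight (x y : R) : R := expR (- V (x - y) - U *+ 2).

(** The types [A], [B] are fixed and the available vertices are subsets. Two windows can thus share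
    one edge type, and a random window can live on the fixed index type ['I_N]. *)
Definition matching (A0 : {set A}) (B0 : {set B}) (M : {set A * B}) : bool :=
  [forall e in M, (e.1 \in A0) && (e.2 \in B0)] &&
  [forall e in M, forall e' in M, (e.1 == e'.1) || (e.2 == e'.2) ==> (e == e')].

Lemma matchingP (A0 : {set A}) (B0 : {set B}) (M : {set A * B}) :
  reflect ((forall e, e \in M -> e.1 \in A0 /\ e.2 \in B0) /\
           (forall e e', e \in M -> e' \in M -> e.1 = e'.1 \/ e.2 = e'.2 -> e = e'))
    (matching A0 B0 M).
Proof.
apply: (iffP andP) => -[h1 h2]; split.
- by move=> e eM; apply/andP; exact: (forall_inP h1).
- move=> e e' eM e'M ee'; apply/eqP.
  have /implyP := forall_inP (forall_inP h2 e eM) e' e'M; apply.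
  by case: ee' => ->; rewrite eqxx ?orbT.
- by apply/forall_inP => e eM; apply/andP; exact: h1.
- apply/forall_inP => e eM; apply/forall_inP => e' e'M; apply/implyP => ee'.
  by apply/eqP; apply: h2 => //; case/orP: ee' => /eqP ->; [left|right].
Qed.

Definition partner (M : {set A * B}) : option R :=
  omap (fun e => g e.2) [pick e in M | f e.1 == 0].

Variables (S T : {fset R}) (A0 : {set A}) (B0 : {set B}).
Hypothesis f_inj : {in A0 &, injective f}.
Hypothesis g_inj : {in B0 &, injective g}.
Hypothesis imS : forall r, (r \in S) = [exists a in A0, f a == r].
Hypothesis imT : forall r, (r \in T) = [exists a in B0, g a == r].

(** The constant factor is the weight of the empty matching; it cancels in [gibbs_at0E]. *)
Lemma gibbs_weightE (pi : {ffun S -> option T}) : partial_bijection pi ->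
  gibbs_weight V U pi = expR (\sum_(s : S) U + \sum_(t : T) U) *
    \prod_(s : S) \prod_(t : T | pi s == Some t) edge_weight (val s) (val t).
Proof.
move=> pb.
rewrite /edge_weight; under [X in _ = _ * X]eq_bigr do rewrite -expR_sum; rewrite -expR_sum
    -expRD; congr expR.
have sU : \sum_(s | pi s == None) U =
    \sum_(s : S) U - \sum_(s : S) \sum_(t | pi s == Some t) U.
  rewrite [X in _ = X - _](bigID (fun s => pi s == None)) /= -addrA [X in _ = _ + X](_ : _ = 0)
      ?addr0//.
  apply/eqP; rewrite subr_eq0 eq_sym; apply/eqP.
  rewrite [LHS](bigID (fun s => pi s == None)) /= [X in X + _]big1 ?add0r => [|s /eqP ->]; last
      by rewrite big_pred0.
  apply: eq_bigr => s; case: (pi s) => // t _.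
  by rewrite (big_pred1 t) // => t'; rewrite eq_sym.
(* Injectivity of [pi] enters only here: a matched [t] must be counted for exactly one [s]. *)
have tU : \sum_(t | [forall s, pi s != Some t]) U =
    \sum_(t : T) U - \sum_(s : S) \sum_(t | pi s == Some t) U.
  rewrite (exchange_big_dep xpredT) //=.
  rewrite [X in _ = X - _](bigID (fun t => [forall s, pi s != Some t])) /= -addrA [X in _ = _ +
      X](_ : _ = 0) ?addr0//.
  apply/eqP; rewrite subr_eq0 eq_sym; apply/eqP.
  rewrite [LHS](bigID (fun t => [forall s, pi s != Some t])) /= [X in X + _]big1 ?add0r => [|t
      /forallP h]; last first.
    by rewrite big_pred0 // => s; apply/negbTE.
  apply: eq_bigr => t; rewrite negb_forall => /existsP[s]; rewrite negbK => /eqP pis.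
  rewrite (big_pred1 s) // => s'; apply/eqP/eqP => [h|->//].
  have /forallP/(_ s)/forallP/(_ s') := pb.
  by rewrite pis h eqxx /= => /eqP ->.
have sV : - (\sum_(s | pi s != None) oapp (fun t => V (val s - val t)) 0 (pi s)) =
    \sum_(s : S) \sum_(t | pi s == Some t) - V (val s - val t).
  rewrite -sumrN [RHS](bigID (fun s => pi s != None)) /= [X in _ + X]big1 ?addr0 => [|s]; last
      first.
    by rewrite negbK => /eqP ->; rewrite big_pred0.
  apply: eq_bigr => s; case: (pi s) => // t _ /=.
  by rewrite (big_pred1 t) // => t'; rewrite eq_sym.
rewrite sU tU sV; under [X in _ = _ + X]eq_bigr do rewrite sumrB sumrMnl.
by rewrite sumrB sumrMnl mulr2n; ring.
Qed.

Let a_ex (s : S) : exists a, (a \in A0) && (f a == val s).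
Proof. by apply/existsP; rewrite -imS; exact: valP. Qed.
Let b_ex (t : T) : exists b, (b \in B0) && (g b == val t).
Proof. by apply/existsP; rewrite -imT; exact: valP. Qed.
Let a s := xchoose (a_ex s).
Let b t := xchoose (b_ex t).
Let aA s : a s \in A0. Proof. by have /andP[] := xchooseP (a_ex s). Qed.
Let bB s : b s \in B0. Proof. by have /andP[] := xchooseP (b_ex s). Qed.
Let fa s : f (a s) = val s. Proof. by have /andP[_ /eqP] := xchooseP (a_ex s). Qed.
Let gb s : g (b s) = val s. Proof. by have /andP[_ /eqP] := xchooseP (b_ex s). Qed.
Let a_inj : injective a.
Proof. by move=> s s' h; apply: val_inj; rewrite -!fa h. Qed.
Let b_inj : injective b.
Proof. by move=> s s' h; apply: val_inj; rewrite -!gb h. Qed.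
Let a_surj x : x \in A0 -> exists s, a s = x.
Proof.
move=> xA; have xS : f x \in S by rewrite imS; apply/existsP; exists x; rewrite xA /=.
by exists [` xS]%fset; apply: f_inj => //; rewrite fa.
Qed.
Let b_surj x : x \in B0 -> exists s, b s = x.
Proof.
move=> xB; have xT : g x \in T by rewrite imT; apply/existsP; exists x; rewrite xB /=.
by exists [` xT]%fset; apply: g_inj => //; rewrite gb.
Qed.

(** [toffun] undoes [toset] on every function, but [toset] undoes [toffun] only on matchings;
    elsewhere the pick is an arbitrary choice. *)
Let toffun (M : {set A * B}) : {ffun S -> option T} :=
  [ffun s => [pick t | (a s, b t) \in M]].
Let toset (pi : {ffun S -> option T}) : {set A * B} :=
  [set (a st.1, b st.2) | st in [pred st : S * T | pi st.1 == Some st.2]].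

Let mem_toset pi s t : ((a s, b t) \in toset pi) = (pi s == Some t).
Proof.
apply/imsetP/idP => [[[s' t'] /= + [/a_inj -> /b_inj ->]]|h]; first by rewrite inE.
by exists (s, t).
Qed.

Let tosetK pi : toffun (toset pi) = pi.
Proof.
apply/ffunP => s; rewrite ffunE; case: pickP => [t|h].
  by rewrite mem_toset => /eqP.
by case e: (pi s) => [t|//]; have := h t; rewrite mem_toset e eqxx.
Qed.

Let toset_matching pi : partial_bijection pi -> matching A0 B0 (toset pi).
Proof.
move=> pb; apply/matchingP; split=> [e /imsetP[[s t] _ ->]|]; first by split; [exact: aA|exact: bB].
move=> _ _ /imsetP[[s t] + ->] /imsetP[[s' t'] + ->] /=; rewrite !inE /= => /eqP p1 /eqP p2.
case=> [/a_inj ss|/b_inj tt].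
  by rewrite -ss p1 in p2; case: p2 => ->; rewrite ss.
rewrite tt; rewrite tt in p1.
have /forallP/(_ s)/forallP/(_ s') := pb.
by rewrite p1 p2 eqxx /= => /eqP ->.
Qed.

Let toffunK M : matching A0 B0 M ->
  partial_bijection (toffun M) /\ toset (toffun M) = M.
Proof.
move=> /matchingP[h1 h2].
have tE s t : (toffun M s == Some t) = ((a s, b t) \in M).
  rewrite ffunE; case: pickP => [t' h|h]; last by rewrite h.
  apply/eqP/idP => [[<-]//|h'].
  by have [] := h2 _ _ h h' (or_introl erefl) => /b_inj ->.
split.
  apply/forallP => s; apply/forallP => s'; apply/implyP => /andP[].
  case e : (toffun M s) => [t|//] _ /eqP/esym/eqP; rewrite tE => m'.
  move/eqP: e; rewrite tE => m.
  by have [] := h2 _ _ m m' (or_intror erefl) => /a_inj ->.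
apply/setP => -[x y]; apply/idP/idP.
  by move=> /imsetP[[s t] /=]; rewrite inE /= tE => h ->.
move=> xyM; have [/a_surj[s xs] /b_surj[t yt]] := h1 _ xyM; move: xs yt xyM => /= <- <- h.
by rewrite mem_toset tE.
Qed.

Let partnerE M : matching A0 B0 M -> pb_apply (toffun M) 0 = partner M.
Proof.
move=> mM; have [pb tK] := toffunK _ mM; have /matchingP[h1 h2] := mM.
rewrite /partner; case: pickP => [[x y] /= /andP[xyM /eqP fx0]|no] /=.
  have [/= xA yB] := h1 _ xyM.
  have [s sx] := a_surj _ xA; have [t ty] := b_surj _ yB.
  have s0 : val s = 0 by rewrite -fa sx.
  have -> : pb_apply (toffun M) 0 = omap val (toffun M s).
    by rewrite /pb_apply -s0 valK.
  rewrite -tK -sx -ty mem_toset in xyM.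
  by rewrite (eqP xyM) /= -ty gb.
rewrite /pb_apply; case: insubP => [s _ s0|//] /=.
case e : (toffun M s) => [t|//].
have := no (a s, b t); rewrite -{1}tK mem_toset e eqxx /=.
by rewrite fa s0 eqxx.
Qed.

Let prod_toset pi : partial_bijection pi ->
  \prod_(s : S) \prod_(t : T | pi s == Some t) edge_weight (val s) (val t) =
  wt (fun e => edge_weight (f e.1) (g e.2)) (toset pi).
Proof.
move=> pb; rewrite /wt /toset big_imset /=; last first.
  by move=> [s t] [s' t'] _ _ [/a_inj -> /b_inj ->].
rewrite pair_big_dep /=; apply: eq_big => [[s t]|[s t] _] /=; first by rewrite inE.
by rewrite fa gb.
Qed.

(** Used with [pred1 y] for the numerator of [gibbs_at0] and with [predT] for its partition
    function. *)
Let sum_transport (Q : pred (option R)) :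
  \sum_(pi : {ffun S -> option T} | partial_bijection pi && Q (pb_apply pi 0)) gibbs_weight V U pi =
  expR (\sum_(s : S) U + \sum_(t : T) U) *
  \sum_(M | matching A0 B0 M && Q (partner M))
    wt (fun e => edge_weight (f e.1) (g e.2)) M.
Proof.
rewrite (reindex_onto toset toffun) /=; last by move=> M /andP[/toffunK[_ ->]].
rewrite mulr_sumr; apply: eq_big => [pi|pi /andP[pb _]].
  rewrite tosetK eqxx andbT.
  have [pb|npb] := boolP (partial_bijection pi).
    by rewrite toset_matching //= -partnerE ?tosetK ?toset_matching.
  apply/esym/negbTE; rewrite negb_and; apply/orP; left.
  by apply/negP => /toffunK[]; rewrite tosetK (negbTE npb).
by rewrite gibbs_weightE // prod_toset.
Qed.

Lemma gibbs_at0E y : gibbs_at0 V U S T y =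
  ratio (fun e => edge_weight (f e.1) (g e.2)) partner (matching A0 B0) y.
Proof.
rewrite /gibbs_at0 /gibbs /ratio -mulr_suml.
rewrite (sum_transport (pred1 y)) /=.
have -> : \sum_(pi : {ffun S -> option T} | partial_bijection pi) gibbs_weight V U pi =
    expR (\sum_(s : S) U + \sum_(t : T) U) *
    \sum_(M | matching A0 B0 M) wt (fun e => edge_weight (f e.1) (g e.2)) M.
  have := sum_transport predT; rewrite (eq_bigl (@partial_bijection _ S T)).
    by move=> ->; congr (_ * _); apply: eq_bigl => M; rewrite andbT.
  by move=> pi; rewrite andbT.
rewrite invfM mulrACA mulfV ?mul1r //.
by rewrite gt_eqF // expR_gt0.
Qed.

End Matching.

Local Open Scope classical_set_scope.
Local Open Scope ring_scope.

(** * Decay of correlations *)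

Section Decay.
Context {R : realType}.

Definition peak (t y : R) : R := expR (- `| `|y| - t |).

Lemma peak_ge0 t y : 0 <= peak t y. Proof. exact: expR_ge0. Qed.

(** The distance is at least [|y| - |x| = (b - a) + (a - |x|) + (|y| - b)], which splits the
    exponential into a gap factor and one peak for each end. *)
Lemma expR_cross_le (a b x y : R) : `|x| <= a -> a <= b -> b <= `|y| ->
  expR (- `|x - y|) <= expR (- (b - a)) * (peak a x * peak b y).
Proof.
move=> xa ab bY; rewrite /peak -!expRD ler_expR.
rewrite (ler0_norm (_ : `|x| - a <= 0)) ?subr_le0 //.
rewrite (ger0_norm (_ : 0 <= `|y| - b)) ?subr_ge0 //.
have : `|y| - `|x| <= `|x - y| by rewrite distrC; exact: lerB_dist.
lra.
Qed.

(** A bound on a possibly infinite sum, stated through finite subsets so that it applies at once to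
    windows. *)
Definition peak_bounded (X : set R) (t M : R) : Prop :=
  forall S : {fset R}, [set` S] `<=` X -> \sum_(s <- S) peak t s <= M.

(** Each point of [[-K, K]] contributes at least [expR (- (|K| + |t|))] to the peak sum, so only
    finitely many fit below [M]. *)
Lemma peak_bounded_finite (X : set R) (t M K : R) :
  peak_bounded X t M -> finite_set (X `&` `[- K, K]).
Proof.
move=> XM; apply: contrapT => inf.
have [n nM] : exists n : nat, M < n%:R * expR (- (`|K| + `|t|)).
  pose c := expR (- (`|K| + `|t|)).
  have c0 : 0 < c by exact: expR_gt0.
  exists (Num.bound (`|M| / c)).
  have Mc : 0 <= `|M| / c by rewrite divr_ge0 // ltW.
  rewrite -ltr_pdivrMr //; apply: le_lt_trans _ (archi_boundP Mc).
  by rewrite ler_pM2r ?invr_gt0// ler_norm.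
have [S SX nS] := infinite_set_fset n inf.
have /XM : [set` S] `<=` X by move=> x /SX[].
apply/negP; rewrite -ltNge (lt_le_trans nM) //.
apply: (@le_trans _ _ (\sum_(s <- S) expR (- (`|K| + `|t|)))).
  rewrite big_const_seq count_predT iter_addr_0 -[leRHS]mulr_natl.
  by rewrite ler_wpM2r ?expR_ge0// ler_nat.
rewrite big_seq [leRHS]big_seq; apply: ler_sum => s /SX[_] /=.
rewrite in_itv /= => /andP[h1 h2].
rewrite /peak ler_expR lerN2; apply: le_trans (ler_normB _ _) _.
rewrite lerD2r normr_id; have : `|s| <= K by rewrite ler_norml h1 h2.
by move=> /le_trans; apply; exact: ler_norm.
Qed.

Lemma mem_window (X : set R) (K : R) r : finite_set (X `&` `[- K, K]) ->
  (r \in window K X) = (r \in X) && (`|r| <= K).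
Proof.
move=> fX; rewrite /window in_fset_set //.
by apply/idP/andP; rewrite !inE /= in_itv /= -ler_norml => -[].
Qed.

(** On an infinite set [fset_set] is empty, and the inclusion is then trivial. *)
Lemma window_sub (X : set R) (K : R) : [set` window K X] `<=` X.
Proof.
move=> r /=; have [fX|iX] := pselect (finite_set (X `&` `[- K, K])).
  by rewrite mem_window // => /andP[/set_mem].
by rewrite /window /fset_set; case: pselect.
Qed.

Lemma peak_bounded_sum (X : set R) (t M : R) (S : {fset R}) :
  [set` S] `<=` X -> peak_bounded X t M -> \sum_(s : S) peak t (val s) <= M.
Proof.
by move=> SX XM; rewrite -(big_seq_fsetE _ _ xpredT (peak t)); exact: XM.
Qed.

Section Levels.
Variables (n : nat) (t : nat -> R).
Hypothesis t_homo : forall j k, (j <= k)%N -> t j <= t k.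

(** A point outside all [n] intervals receives the default level [n]. *)
Definition level (v : R) : nat := find (fun j => `|v| <= t j) (iota 0 n).

Lemma level_le v : (level v <= n)%N.
Proof. by apply: leq_trans (find_size _ _) _; rewrite size_iota. Qed.

Lemma level_leE v k : (k < n)%N -> (level v <= k)%N = (`|v| <= t k).
Proof.
move=> kn; apply/idP/idP => h; last first.
  rewrite leqNgt; apply/negP => /(before_find 0%N).
  by rewrite nth_iota // add0n h.
have ln : (level v < n)%N by exact: leq_ltn_trans kn.
have : has (fun j => `|v| <= t j) (iota 0 n) by rewrite has_find size_iota.
move=> /(nth_find 0%N); rewrite nth_iota // add0n => /le_trans; apply.
exact: t_homo.
Qed.

End Levels.

Variables (V : R -> R) (U C : R).
Hypothesis C_ge0 : 0 <= C.
Hypothesis weight_le : forall x y, edge_weight V U x y <= C * expR (- `|x - y|).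

Lemma edge_weight_ge0 x y : 0 <= edge_weight V U x y.
Proof. exact: expR_ge0. Qed.

(** The factor 2 counts the two orientations, inner end in [S] or in [T]; in each, the double sum
    factors into two peak sums. The case [a = b] serves for one boundary, [a < b] for jumps over
    two. *)
Lemma crossing_sum_le (X Y : set R) (S T : {fset R}) (a b M : R) :
  [set` S] `<=` X -> [set` T] `<=` Y -> a <= b ->
  peak_bounded X a M -> peak_bounded Y b M ->
  peak_bounded Y a M -> peak_bounded X b M ->
  \sum_(e : S * T | (`|val e.1| <= a) && (b < `|val e.2|)
                 || (`|val e.2| <= a) && (b < `|val e.1|))
     edge_weight V U (val e.1) (val e.2) <= 2 * (C * M ^+ 2 * expR (- (b - a))).
Proof.
move=> SX TY ab XaM YbM YaM XbM.
have S0 := peak_bounded_sum _ _ _ _ SX; have T0 := peak_bounded_sum _ _ _ _ TY.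
have M0 : 0 <= M by apply: le_trans (S0 _ _ XaM); apply: sumr_ge0 => s _; exact: peak_ge0.
apply: (@le_trans _ _ (\sum_(e : S * T)
   C * expR (- (b - a)) * (peak a (val e.1) * peak b (val e.2) +
     peak b (val e.1) * peak a (val e.2)))).
  rewrite big_mkcond /=; apply: ler_sum => e _.
  have P0 a' b' : 0 <= peak a' (val e.1) * peak b' (val e.2) by rewrite mulr_ge0 ?peak_ge0.
  case: ifP => [h|_]; last first.
    by rewrite mulr_ge0 // ?addr_ge0// mulr_ge0 ?expR_ge0.
  apply: le_trans (weight_le _ _) _; rewrite -mulrA ler_wpM2l //.
  case/orP: h => /andP[h1 h2].
    apply: le_trans (expR_cross_le a b _ _ h1 ab (ltW h2)) _.
    by rewrite ler_wpM2l ?expR_ge0 // lerDl.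
  rewrite distrC; apply: le_trans (expR_cross_le a b _ _ h1 ab (ltW h2)) _.
  by rewrite ler_wpM2l ?expR_ge0 // [peak a _ * _]mulrC lerDr.
rewrite -mulr_sumr big_split /=.
rewrite -(pair_bigA _ (fun s t => peak a (val s) * peak b (val t))) /=.
rewrite -(pair_bigA _ (fun s t => peak b (val s) * peak a (val t))) /=.
rewrite -!big_distrlr /=.
have -> : 2 * (C * M ^+ 2 * expR (- (b - a))) = C * expR (- (b - a)) * (M * M + M * M) by ring.
apply: ler_wpM2l; first by rewrite mulr_ge0 ?expR_ge0.
by apply: lerD; apply: ler_pM; rewrite ?S0 ?T0 //; apply: sumr_ge0 => s _; exact: peak_ge0.
Qed.

Section Windows.
Variables (X Y : set R) (M : R) (n : nat) (t : nat -> R).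
Hypothesis t_homo : forall j k, (j <= k)%N -> t j <= t k.
Hypothesis t0 : 0 <= t 0%N.
Hypothesis XM : forall k, peak_bounded X (t k) M.
Hypothesis YM : forall k, peak_bounded Y (t k) M.

(** Both measures are realised on the edges of the larger window, where [tv_bound] applies with the
    levels of the endpoints. The weight crossing one boundary is at most [2 * C * M ^+ 2], so
    [1 + w <= expR w] bounds the class product by its exponential, and the square of that is [B]. *)
Lemma window_tv_le (K K' gap : R) (L : seq (option R)) :
  (forall k, t k + gap <= t k.+1) -> 0 <= gap ->
  (forall k, (k < n)%N -> t k <= K) -> (forall k, (k < n)%N -> t k <= K') ->
  uniq L ->
  \sum_(y <- L) `|gibbs_at0 V U (window K X) (window K Y) y -
                  gibbs_at0 V U (window K' X) (window K' Y) y| <=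
  2 * (2 * (n%:R * (2 * (C * M ^+ 2 * expR (- gap)))) +
       (1 - (expR (2 * (2 * (C * M ^+ 2))))^-1) ^+ n).
Proof.
move=> tgap gap0 tK tK' uL.
have M0 : 0 <= M by have := XM 0%N fset0; rewrite big_nil; apply => x.
have finX k : finite_set (X `&` `[- k, k]) by exact: peak_bounded_finite (XM 0%N).
have finY k : finite_set (Y `&` `[- k, k]) by exact: peak_bounded_finite (YM 0%N).
pose Km := Num.max K K'.
pose S := window Km X; pose T := window Km Y.
pose ins k := [set s : S | `|val s| <= k]%SET.
pose int k := [set s : T | `|val s| <= k]%SET.
have val_inj' (Z : {fset R}) (D : {set Z}) : {in D &, injective (val : Z -> R)}.
  by move=> x y _ _; exact: val_inj.
have imE (Z : set R) k r : finite_set (Z `&` `[- k, k]) -> finite_set (Z `&` `[- Km, Km]) ->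
   k <= Km -> (r \in window k Z) =
   [exists a in [set s : window Km Z | `|val s| <= k]%SET, val a == r].
  move=> fk fm km; apply/idP/existsP => [|[[z zZ]] /=].
    rewrite mem_window // => /andP[rZ rk].
    have rm : r \in window Km Z by rewrite mem_window // rZ (le_trans rk).
    by exists [` rm]%fset; rewrite inE /= rk eqxx.
  rewrite inE /= => /andP[zk /eqP <-]; rewrite mem_window // zk andbT.
  by move: zZ; rewrite mem_window // => /andP[].
have Kle : K <= Km by rewrite le_max lexx.
have K'le : K' <= Km by rewrite le_max lexx orbT.
have gE k y : k <= Km -> gibbs_at0 V U (window k X) (window k Y) y =
    ratio (fun e : S * T => edge_weight V U (val e.1) (val e.2))
      (partner val val) (matching (ins k) (int k)) y.
  move=> kK; apply: gibbs_at0E => [||r|r].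
  - exact: val_inj'.
  - exact: val_inj'.
  - exact: (imE _ _ _ (finX k) (finX Km) kK).
  - exact: (imE _ _ _ (finY k) (finY Km) kK).
under eq_bigr do rewrite !gE //.
pose l1 (e : S * T) := level n t (val e.1); pose l2 (e : S * T) := level n t (val e.2).
pose lo e := minn (l1 e) (l2 e); pose hi e := maxn (l1 e) (l2 e).
have SX : [set` S] `<=` X by exact: window_sub.
have TY : [set` T] `<=` Y by exact: window_sub.
have lev v k : (k < n)%N -> (level n t v <= k)%N = (`|v| <= t k) by exact: level_leE.
have match_D1 k (N : {set S * T}) e :
    matching (ins k) (int k) N -> matching (ins k) (int k) (N :\ e)%SET.
  move=> /matchingP[h1 h2]; apply/matchingP; split=> [x|x y].
    by rewrite in_setD1 => /andP[_ /h1].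
  by rewrite !in_setD1 => /andP[_ xN] /andP[_ yN]; exact: h2.
have match0 k : matching (ins k) (int k) finset.set0.
  by apply/matchingP; split=> [x|x y]; rewrite inE.
have layer_flip k (N : {set bool * (S * T)}) c e :
    (e \in layer (flip hi k @: N)%SET c) =
    ((if (hi e <= k)%N then ~~ c else c, e) \in N).
  by rewrite inE mem_flip.
(* A swapped edge has both ends within [t k], hence inside either window. An edge that is not
   swapped has [hi > k], and being uncrossed also [lo > k], so it cannot share an endpoint with a
   swapped one. *)
have flip_match k (N : {set bool * (S * T)}) (kc : bool -> R) c : (k < n)%N ->
    (forall k, (k < n)%N -> t k <= kc c) ->
    (forall c, matching (ins (kc c)) (int (kc c)) (layer N c)) ->
    uncrossed lo hi k N ->
    matching (ins (kc c)) (int (kc c)) (layer (flip hi k @: N)%SET c).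
  move=> kn tkc mN /forall_inP uN; have mc := fun c => elimT (matchingP _ _ _) (mN c).
  apply/matchingP; split=> [e|e e'].
    rewrite layer_flip; case: ifP => [hk eN|_ eN]; last first.
      by have [h _] := mc c; apply: h; rewrite inE.
    rewrite !inE; move: hk; rewrite /hi geq_max !lev // => /andP[h1 h2].
    by split; [apply: le_trans h1 _|apply: le_trans h2 _]; exact: tkc.
  rewrite !layer_flip; case: ifP => hk eN; case: ifP => hk' eN' ee'.
  - by have [_] := mc (~~ c); apply=> //; rewrite inE.
  - have := uN _ eN'; rewrite /crosses /= ltnNge hk' /= andbT -ltnNge.
    move: hk; rewrite /lo /hi leq_min geq_max => /andP[h1 h2] /andP[h3 h4].
    case: ee' => ee'.
      by move: h3; rewrite /l1 -ee' ltnNge -/(l1 e) h1.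
    by move: h4; rewrite /l2 -ee' ltnNge -/(l2 e) h2.
  - have := uN _ eN; rewrite /crosses /= ltnNge hk /= andbT -ltnNge.
    move: hk'; rewrite /lo /hi leq_min geq_max => /andP[h1 h2] /andP[h3 h4].
    case: ee' => ee'.
      by move: h3; rewrite /l1 ee' ltnNge -/(l1 e') h1.
    by move: h4; rewrite /l2 ee' ltnNge -/(l2 e') h2.
  - by have [_] := mc c; apply=> //; rewrite inE.
have bothE N : both (matching (ins K) (int K)) (matching (ins K') (int K')) N ->
    forall c : bool, matching (ins (if c then K' else K)) (int (if c then K' else K)) (layer N c).
  by move=> /andP[h1 h2] [].
pose B := expR (2 * (2 * (C * M ^+ 2))).
have CM0 : 0 <= C * M ^+ 2 by rewrite mulr_ge0 // sqr_ge0.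
apply: le_trans (tv_bound (fun e : S * T => edge_weight V U (val e.1) (val e.2))
   (fun e => edge_weight_ge0 _ _) (matching (ins K) (int K)) (matching (ins K') (int K'))
   lo hi n (partner val val) (match_D1 K) (match_D1 K') _ _
   B L (match0 K) (match0 K') _ uL _) _.
- by move=> k N kn /bothE bN uN; apply/andP; split;
    [apply: (flip_match _ _ (fun c => if c then K' else K) false)
    |apply: (flip_match _ _ (fun c => if c then K' else K) true)].
(* As [0 <= t 0], an edge at the origin has [lo <= k]. If it is not swapped it crosses level [k],
   hence is absent from both copies. *)
- move=> k N c kn _ /forall_inP uN; rewrite /partner; congr omap.
  apply: eq_pick => e /=; case: eqP => [e0|]; rewrite ?andbT ?andbF //.
  rewrite layer_flip inE; case: ifP => // hk.
  have cr c' : crosses lo hi k (c', e).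
    have ve : val e.1 = 0 := e0.
    rewrite /crosses /= [(k < _)%N]ltnNge hk andbT /lo geq_min /l1 ve lev // normr0.
    by rewrite (le_trans t0) // t_homo.
  by transitivity false; [|apply/esym]; apply/negP => /uN; rewrite cr.
- by rewrite -expR0 ler_expR !mulr_ge0.
- move=> k kn; rewrite /B [X in _ <= expR X]mulrC expRM_natr.
  rewrite lerXn2r ?nnegrE ?expR_ge0 //; first by apply: prodr_ge0 => e _; rewrite addr_ge0
      ?edge_weight_ge0.
  apply: (@le_trans _ _ (expR (\sum_(e | (lo e == k) && (hi e == k.+1))
      edge_weight V U (val e.1) (val e.2)))).
    rewrite expR_sum; apply: ler_prod => e _.
    by rewrite addr_ge0 ?edge_weight_ge0 //= expR_ge1Dx.
  rewrite ler_expR.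
  have := crossing_sum_le X Y S T (t k) (t k) M SX TY (lexx _) (XM k) (YM k) (YM k) (XM k).
  rewrite subrr oppr0 expR0 mulr1; apply: le_trans.
  apply: ler_sum_sub => [e|e]; first exact: edge_weight_ge0.
  by rewrite !ltNge -!lev // -!ltnNge /lo /hi /l1 /l2; lia.
rewrite ler_pM2l // lerD2r ler_pM2l //.
(* Jumps are sorted by their lower level [k]. Since [hi e <= n], a jump forces [k.+1 < n], so that
   [level_leE] applies at both boundaries. *)
apply: (@le_trans _ _ (\sum_(k < n) \sum_(e : S * T | ((k.+1 < n) && (lo e == k) && (k.+1 < hi
    e))%N)
    edge_weight V U (val e.1) (val e.2))).
  rewrite (exchange_big_dep xpredT) //= big_mkcond; apply: ler_sum => e _.
  case: ifP => [h|_]; last by apply: sumr_ge0 => k _; exact: edge_weight_ge0.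
  have hn : (hi e <= n)%N by rewrite geq_max !level_le.
  have kn : (lo e < n)%N by lia.
  rewrite (bigD1 (Ordinal kn)) /=; last by lia.
  by rewrite lerDl; apply: sumr_ge0 => k _; exact: edge_weight_ge0.
apply: (@le_trans _ _ (\sum_(k < n) 2 * (C * M ^+ 2 * expR (- gap)))); last first.
  by rewrite sumr_const card_ord -[leLHS]mulr_natl.
apply: ler_sum => k _; have [kn|kn] := ltnP k.+1 n; last first.
  by rewrite big1 ?mulr_ge0 ?expR_ge0 // => e; lia.
apply: (@le_trans _ _ (2 * (C * M ^+ 2 * expR (- (t k.+1 - t k))))); last first.
  rewrite ler_pM2l // ler_wpM2l // ler_expR lerN2 lerBrDl; exact: tgap.
apply: le_trans (crossing_sum_le X Y S T (t k) (t k.+1) M SX TY _ _ _ _ _) => //; last first.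
  exact: t_homo.
apply: ler_sum_sub => [e|e]; first exact: edge_weight_ge0.
have kn' : (k < n)%N by exact: ltnW.
by rewrite !ltNge -!lev // -!ltnNge /lo /hi /l1 /l2; lia.
Qed.

End Windows.

Lemma gibbs_at0_cauchy (X Y : set R) (M eps : R) :
  (forall T0 : nat, exists t : nat, [/\ (T0 <= t)%N,
     peak_bounded X t%:R M & peak_bounded Y t%:R M]) ->
  0 < eps ->
  exists K0 : R, forall K K', K0 <= K -> K0 <= K' ->
    forall L : seq (option R), uniq L ->
    \sum_(y <- L) `|gibbs_at0 V U (window K X) (window K Y) y -
                    gibbs_at0 V U (window K' X) (window K' Y) y| <= eps.
Proof.
move=> good eps0.
set c := C * M ^+ 2; have c0 : 0 <= c by rewrite mulr_ge0 // sqr_ge0.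
set B := expR (2 * (2 * c)).
have B1 : 1 <= B by rewrite /B -expR0 ler_expR mulr_ge0 // mulr_ge0.
have B0 : 0 < B by exact: expR_gt0.
have [n nle] : exists n : nat, (1 - B^-1) ^+ n <= eps / 4.
  have /cvg_expr : `|1 - B^-1| < 1.
    by rewrite ger0_norm ?subr_ge0 ?invf_le1 // ltrBlDr ltrDl invr_gt0.
  move=> /cvgr0_norm_le /(_ (eps / 4)); rewrite divr_gt0 // => /(_ isT)[n _ /(_ n)].
  by move=> /(_ (leqnn n)) h; exists n; apply: le_trans (ler_norm _) h.
(* The left side is the jump term of [window_tv_le]; its other term is at most [2 * (eps / 4)]. The
   witness works because [expR g >= 1 + g]. *)
have [gap gaple] : exists gap : nat, 4 * (2 * (n%:R * (c * expR (- gap%:R)))) <= eps / 2.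
  pose a := 4 * (2 * (n%:R * c)); have a0 : 0 <= a by do 3 (rewrite mulr_ge0 //).
  exists (Num.bound (a / (eps / 2))).
  set g := Num.bound _.
  have -> : 4 * (2 * (n%:R * (c * expR (- g%:R)))) = a * expR (- g%:R) by rewrite /a; ring.
  rewrite expRN ler_pdivrMr ?expR_gt0 //.
  have ga : a / (eps / 2) < g%:R by apply: archi_boundP; rewrite divr_ge0 // divr_ge0 // ltW.
  rewrite mulrC -ler_pdivrMr ?divr_gt0 //; apply: le_trans (ltW ga) _.
  by apply: le_trans (expR_ge1Dx _); rewrite lerDr.
pose next T0 : nat := projT1 (cid (good T0)).
have nextP T0 : [/\ (T0 <= next T0)%N, peak_bounded X (next T0)%:R M &
    peak_bounded Y (next T0)%:R M] := projT2 (cid (good T0)).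
pose tn := fix tn k : nat := if k is j.+1 then next (tn j + gap)%N else next 0%N.
have tnS k : (tn k + gap <= tn k.+1)%N by have [] := nextP (tn k + gap)%N.
have tnX k : peak_bounded X (tn k)%:R M by case: k => [|k] /=; [case: (nextP 0%N)|case: (nextP
    (tn k + gap)%N)].
have tnY k : peak_bounded Y (tn k)%:R M by case: k => [|k] /=; [case: (nextP 0%N)|case: (nextP
    (tn k + gap)%N)].
have tn_homo : forall j k, (j <= k)%N -> (tn j)%:R <= (tn k)%:R :> R.
  move=> j k /subnK <-; elim: (k - j)%N => [|i IH]; rewrite ?add0n //.
  apply: le_trans IH _; rewrite addSn ler_nat.
  by apply: leq_trans (tnS _); exact: leq_addr.
exists (tn n)%:R => K K' hK hK' L uL.
apply: le_trans (window_tv_le X Y M n (fun k => (tn k)%:R) tn_homo _ tnX tnY K K' gap%:R L _ _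
    _ _ uL) _ => //.
- by move=> k; rewrite -natrD ler_nat.
- by move=> k kn; apply: le_trans hK; apply: tn_homo; exact: ltnW.
- by move=> k kn; apply: le_trans hK'; apply: tn_homo; exact: ltnW.
by rewrite -/c -/B; lra.
Qed.

End Decay.

(** * Measurability of the window measures *)

Section BoolMeasurable.
Context {d : measure_display} {Om : measurableType d} {R : realType}.

Lemma measurable_big_or (I : Type) (s : seq I) (b : I -> Om -> bool) :
  (forall i, measurable_fun setT (b i)) ->
  measurable_fun setT (fun w => has (b ^~ w) s).
Proof.
move=> mb; elim: s => [|i s IH] /=; first exact: measurable_cst.
exact: measurable_or.
Qed.

Lemma measurable_big_and (I : Type) (s : seq I) (b : I -> Om -> bool) :
  (forall i, measurable_fun setT (b i)) ->
  measurable_fun setT (fun w => all (b ^~ w) s).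
Proof.
move=> mb; elim: s => [|i s IH] /=; first exact: measurable_cst.
exact: measurable_and.
Qed.

Lemma measurable_eqb (b : Om -> bool) (c : bool) :
  measurable_fun setT b -> measurable_fun setT (fun w => b w == c).
Proof.
move=> mb; case: c.
  by rewrite (_ : (fun w => b w == true) = b) //; apply/funext => w; rewrite eqb_id.
rewrite (_ : (fun w => b w == false) = (fun w => ~~ b w)); first exact: measurable_neg.
by apply/funext => w; rewrite eqbF_neg.
Qed.

(** The event is a finite union over the truth assignments accepted by [G]. Combinatorial events
    such as [matching] are handled this way without being unfolded. *)
Lemma measurable_finite_bool (E : finType) (b : E -> Om -> bool)
    (G : {ffun E -> bool} -> bool) :
  (forall e, measurable_fun setT (b e)) ->
  measurable_fun setT (fun w => G [ffun e => b e w]).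
Proof.
move=> mb.
rewrite (_ : (fun w => _) = (fun w => has (fun c : {ffun E -> bool} =>
    all (fun e => b e w == c e) (enum E)) [seq c <- enum {ffun E -> bool} | G c])).
  apply: (measurable_big_or _ _ (fun (c : {ffun E -> bool}) w => all (fun e => b e w == c e)
      (enum E))) => c.
  apply: (measurable_big_and _ _ (fun e w => b e w == c e)) => e.
  exact: measurable_eqb.
apply/funext => w; apply/idP/hasP => [Gb|[c]].
  exists [ffun e => b e w]; first by rewrite mem_filter Gb mem_enum.
  by apply/allP => e _; rewrite ffunE.
rewrite mem_filter => /andP[Gc _] /allP h.
suff -> : [ffun e => b e w] = c by [].
by apply/ffunP => e; rewrite ffunE; apply/eqP/h; rewrite mem_enum.
Qed.

Lemma measurable_asbool (P : Om -> Prop) :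
  measurable [set w | P w] -> measurable_fun setT (fun w => `[< P w >]).
Proof.
move=> mP; apply: (measurable_fun_bool true); rewrite setTI.
by rewrite (_ : _ @^-1` _ = [set w | P w]) //; apply/seteqP; split => w /=;
  [move=> /asboolP | move=> ?; apply/asboolP].
Qed.

Lemma measurable_boolset (b : Om -> bool) :
  measurable_fun setT b -> measurable [set w | b w].
Proof. by move=> /(_ measurableT [set true] I); rewrite setTI. Qed.

Lemma measurable_esum_nat (h : nat -> Om -> \bar R) :
  (forall k w, (0 <= h k w)%E) -> (forall k, measurable_fun setT (h k)) ->
  measurable_fun setT (fun w => \esum_(k in [set: nat]) h k w).
Proof.
move=> h0 mh.
rewrite (_ : (fun w => _) = (fun w => \sum_(k <oo | k \in xpredT) h k w)%E).
  by apply: ge0_emeasurable_sum => // k.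
apply/funext => w; rewrite -nneseries_esumT // => k; exact: h0.
Qed.

End BoolMeasurable.

(** * Random point sets given by enumerations *)

Section Enumerated.
Context {d : measure_display} {Om : measurableType d} {R : realType}.
Variables (z : nat -> Om -> R) (v : nat -> Om -> bool).
Hypothesis mz : forall n, measurable_fun setT (z n).
Hypothesis mv : forall n, measurable_fun setT (v n).

Definition points (w : Om) : set R := [set z n w | n in [set n | v n w]].

(* The enumeration [z] may repeat points; [first n] selects the first occurrence. *)
Definition first (n : nat) (w : Om) : bool :=
  v n w && all (fun m => ~~ (v m w && (z m w == z n w))) (iota 0 n).

Lemma measurable_first n : measurable_fun setT (first n).
Proof.
apply: measurable_and => //.
apply: (measurable_big_and _ _ (fun m w => ~~ (v m w && (z m w == z n w)))) => m.
by apply: measurable_neg; apply: measurable_and => //; exact: measurable_fun_eqr.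
Qed.

Lemma first_valid n w : first n w -> v n w. Proof. by case/andP. Qed.

Lemma first_point n w : first n w -> points w (z n w).
Proof. by move=> /first_valid vn; exists n. Qed.

Lemma first_exists w r : points w r -> exists2 n, first n w & z n w = r.
Proof.
move=> rw; have ex : exists n, v n w && (z n w == r).
  by case: rw => n vn <-; exists n; rewrite eqxx andbT.
case: (ex_minnP ex) => n /andP[vn /eqP zn] mn; exists n => //.
rewrite /first vn /=; apply/allP => m; rewrite mem_iota add0n => /andP[_ mlt].
by apply: contraL mlt => h; rewrite -leqNgt mn // -zn.
Qed.

Lemma first_inj w n m : first n w -> first m w -> z n w = z m w -> n = m.
Proof.
wlog nm : n m / (n <= m)%N => [hw|fn /andP[_ /allP h] znm].
  by have [nm|/ltnW mn] := leqP n m; [exact: hw|move=> fn fm e; apply/esym/hw].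
move: nm; rewrite leq_eqVlt => /orP[/eqP //|nm].
have := h n; rewrite mem_iota /= nm => /(_ isT).
by rewrite (first_valid _ _ fn) znm eqxx.
Qed.

Lemma esum_points (h : R -> \bar R) w : (forall r, (0 <= h r)%E) ->
  \esum_(r in points w) h r =
  \esum_(n in [set: nat]) (if first n w then h (z n w) else 0%E).
Proof.
move=> h0.
have -> : points w = [set z n w | n in [set n | first n w]].
  apply/seteqP; split => [r /first_exists[n fn <-]|r [n fn <-]]; first by exists n.
  exact: first_point.
rewrite (esum_image [set n | first n w] (z ^~ w) h); last first.
  by move=> n m; rewrite !inE => fn fm; exact: first_inj.
rewrite esum_mkcond; apply: eq_esum => n _.
by rewrite (_ : (n \in [set n | first n w]) = first n w) //; apply/idP/idP; rewrite inE.
Qed.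

Definition in_window (K : R) (n : nat) (w : Om) : bool :=
  first n w && (`|z n w| <= K).

Lemma measurable_in_window K n : measurable_fun setT (in_window K n).
Proof.
apply: measurable_and; first exact: measurable_first.
by apply: measurable_fun_ler => //; exact: measurableT_comp.
Qed.

(** Places the whole window among the first [N] indices, so that it becomes a random subset of
    ['I_N]. *)
Definition within_first (K : R) (N : nat) (w : Om) : Prop :=
  forall n, (N <= n)%N -> ~~ in_window K n w.

Lemma measurable_within_first K N : measurable [set w | within_first K N w].
Proof.
rewrite (_ : [set w | _] = \bigcap_n [set w | (N <= n)%N ==> ~~ in_window K n w]).
  apply: bigcapT_measurable => n; case: (N <= n)%N => /=; last first.
    by rewrite (_ : [set w | true] = setT) //; apply/seteqP; split.
  by apply: measurable_boolset; apply: measurable_neg; exact: measurable_in_window.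
apply/seteqP; split => w h n; first by move=> _; apply/implyP => /h.
by move=> Nn; have /implyP := h n I; exact.
Qed.

Lemma finite_windowP K w :
  finite_set (points w `&` `[- K, K]) <-> exists N, within_first K N w.
Proof.
split=> [/finite_seqP[s sE]|[N hN]].
  pose idx r := xget 0%N [set n | first n w /\ z n w = r].
  exists (\max_(r <- s) idx r).+1 => n Nn; apply/negP => nw.
  have [fn zn] := andP nw.
  have rs : z n w \in s.
    have : [set` s] (z n w) by rewrite -sE; split; [exact: first_point|rewrite /= in_itv /=
        -ler_norml].
    by [].
  have idxn : idx (z n w) = n.
    rewrite /idx; case: xgetP => [m _ [fm zm]|/(_ n)[]//].
    exact: (first_inj w).
  have := @leq_bigmax_seq _ s xpredT idx _ rs isT; rewrite idxn leqNgt => /negP; apply.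
  exact: leq_trans Nn.
apply: (@sub_finite_set _ _ ((z ^~ w) @` `I_N)); last exact/finite_image/finite_II.
move=> r [/first_exists[n fn <-]]; rewrite /= in_itv /= -ler_norml => rK.
exists n => //=; rewrite ltnNge; apply/negP => /hN.
by rewrite /in_window fn rK.
Qed.

Lemma window_imageE K w N : within_first K N w ->
  forall r, (r \in window K (points w)) =
    [exists n in [set n : 'I_N | in_window K n w]%SET, z n w == r].
Proof.
move=> hN r; rewrite mem_window; last by apply/finite_windowP; exists N.
apply/andP/existsP => [[/set_mem/first_exists[n fn zn] rK]|[n]].
  have nw : in_window K n w by rewrite /in_window fn zn.
  have nN : (n < N)%N by rewrite ltnNge; apply/negP => /hN; rewrite nw.
  by exists (Ordinal nN); rewrite inE /= nw zn eqxx.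
rewrite inE => /andP[/andP[fn zK] /eqP <-]; split => //.
by apply/mem_set; exact: first_point.
Qed.

End Enumerated.

(** * Window laws as random variables *)

Section GibbsMeasurable.
Context {d : measure_display} {Om : measurableType d} {R : realType}.
Variables (zX zY : nat -> Om -> R) (vX vY : nat -> Om -> bool).
Hypothesis mzX : forall n, measurable_fun setT (zX n).
Hypothesis mvX : forall n, measurable_fun setT (vX n).
Hypothesis mzY : forall n, measurable_fun setT (zY n).
Hypothesis mvY : forall n, measurable_fun setT (vY n).
Variables (V : R -> R) (U : Om -> R) (K : R).
Hypothesis mV : measurable_fun setT V.
Hypothesis mU : measurable_fun setT U.

(** With an empty side only the empty matching exists. This gives the value on outcomes with an
    infinite window, where [fset_set] returns [fset0]. *)
Lemma gibbs_at0_trivial (u : R) (S T : {fset R}) (y : option R) :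
  S = fset0 \/ T = fset0 -> gibbs_at0 V u S T y = (y == None)%:R.
Proof.
move=> ST0.
have imE (Z : {fset R}) r : (r \in Z) = [exists a in [set: Z]%SET, val a == r].
  apply/idP/existsP => [rZ|[a /andP[_ /eqP <-]]]; last exact: valP.
  by exists [` rZ]%fset; rewrite inE /= eqxx.
rewrite (gibbs_at0E V u val val S T [set: S]%SET [set: T]%SET) //; last 2 first.
- by move=> ? ? _ _; exact: val_inj.
- by move=> ? ? _ _; exact: val_inj.
have M0 (M : {set S * T}) : M = finset.set0.
  apply/setP => -[[s sS] [t tT]]; exfalso.
  by case: ST0 => e; [move: sS; rewrite e|move: tT; rewrite e].
have F0 M : matching [set: S]%SET [set: T]%SET M.
  by rewrite (M0 M); apply/matchingP; split => [x|x y']; rewrite inE.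
have p0 (M : {set S * T}) : partner val val M = None :> option R.
  by rewrite /partner; case: pickP => // -[s t] /andP[]; rewrite (M0 M) inE.
rewrite /ratio.
have sE (P : pred {set S * T}) (f : {set S * T} -> R) : \sum_(M | P M) f M = (P finset.set0)%:R
    * f finset.set0.
  rewrite big_mkcond (big_pred1 finset.set0) => [|M]; last by rewrite (M0 M) /= eqxx.
  by case: (P _); rewrite ?mul1r ?mul0r.
rewrite !sE !F0 p0 /= mul1r [None == y]eq_sym /wt big_set0 mulr1 divr1 //.
Qed.

Definition enough (N : nat) (w : Om) : Prop :=
  within_first zX vX K N w /\ within_first zY vY K N w.

Let A0 N w : {set 'I_N} := [set n : 'I_N | in_window zX vX K n w]%SET.
Let B0 N w : {set 'I_N} := [set n : 'I_N | in_window zY vY K n w]%SET.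
Let fX N w (n : 'I_N) := zX n w.
Let fY N w (n : 'I_N) := zY n w.
Let ew N w (e : 'I_N * 'I_N) := edge_weight V (U w) (fX N w e.1) (fY N w e.2).

Variable y : Om -> option R.
Hypothesis my : (forall w, y w = None) \/
  exists2 g : Om -> R, measurable_fun setT g & forall w, y w = Some (g w).

Let rat N w := ratio (ew N w) (partner (fX N w) (fY N w)) (matching (A0 N w) (B0 N w)) (y w).

Lemma gibbs_enough N w : enough N w ->
  gibbs_at0 V (U w) (window K (points zX vX w)) (window K (points zY vY w)) (y w) = rat N w.
Proof.
move=> [hX hY]; rewrite (gibbs_at0E V (U w) (fX N w) (fY N w) _ _ (A0 N w) (B0 N w)) //.
- move=> n m; rewrite !inE => /andP[fn _] /andP[fm _] e.
  by apply: val_inj; exact: (first_inj zX vX w).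
- move=> n m; rewrite !inE => /andP[fn _] /andP[fm _] e.
  by apply: val_inj; exact: (first_inj zY vY w).
- exact: window_imageE.
- exact: window_imageE.
Qed.

(** The finitely many tests that decide both the matching constraint and whether the partner of the
    origin is [y]. *)
Let atoms N (c : (bool * bool) * 'I_N) (w : Om) : bool :=
  match c.1 with
  | (true, true) => in_window zX vX K c.2 w
  | (true, false) => in_window zY vY K c.2 w
  | (false, true) => zX c.2 w == 0
  | (false, false) => Some (zY c.2 w) == y w
  end.

Let m_atoms N c : measurable_fun setT (@atoms N c).
Proof.
case: c => -[[] []] n; rewrite /atoms /=.
- exact: measurable_in_window.
- exact: measurable_in_window.
- by apply: measurable_fun_eqr.
case: my => [yN|[g mg yS]].
  rewrite (_ : (fun w => _) = cst false); first exact: measurable_cst.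
  by apply/funext => w; rewrite yN.
rewrite (_ : (fun w => _) = (fun w => zY n w == g w)); first exact: measurable_fun_eqr.
by apply/funext => w; rewrite yS.
Qed.

Lemma measurable_matching N (M : {set 'I_N * 'I_N}) :
  measurable_fun setT (fun w => matching (A0 N w) (B0 N w) M).
Proof.
pose G (c : {ffun (bool * bool) * 'I_N -> bool}) :=
  matching [set n | c ((true, true), n)]%SET [set n | c ((true, false), n)]%SET M.
have := measurable_finite_bool _ (@atoms N) G (@m_atoms N).
apply: eq_measurable_fun => w _; rewrite /G.
by congr matching; apply/setP => n; rewrite !inE ffunE.
Qed.

Lemma measurable_matching_partner N (M : {set 'I_N * 'I_N}) :
  measurable_fun setT (fun w => matching (A0 N w) (B0 N w) M &&
    (partner (fX N w) (fY N w) M == y w)).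
Proof.
apply: measurable_and; first exact: measurable_matching.
case: my => [yN|[g mg yS]].
  pose G (c : {ffun (bool * bool) * 'I_N -> bool}) :=
    [pick e in M | c ((false, true), e.1)] == None.
  have := measurable_finite_bool _ (@atoms N) G (@m_atoms N).
  apply: eq_measurable_fun => w _; rewrite /G /partner yN.
  rewrite (eq_pick (Q := fun e => (e \in M) && (fX N w e.1 == 0))) => [|e]; last by rewrite ffunE.
  by case: pickP.
pose G (c : {ffun (bool * bool) * 'I_N -> bool}) :=
  oapp (fun e : 'I_N * 'I_N => c ((false, false), e.2)) false
    [pick e in M | c ((false, true), e.1)].
have := measurable_finite_bool _ (@atoms N) G (@m_atoms N).
apply: eq_measurable_fun => w _; rewrite /G /partner.
rewrite (eq_pick (Q := fun e => (e \in M) && (fX N w e.1 == 0))) => [|e]; last by rewrite ffunE.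
by case: pickP => [e _|_] /=; [rewrite ffunE|rewrite yS].
Qed.

Lemma measurable_rat N : measurable_fun setT (rat N).
Proof.
have mw (M : {set 'I_N * 'I_N}) : measurable_fun setT (fun w => wt (ew N w) M).
  rewrite /wt (_ : (fun w => _) = (fun w => \prod_(e <- enum M) ew N w e)); last first.
    by apply/funext => w; rewrite big_enum.
  apply: (measurable_prod (h := fun e w => ew N w e)) => e _.
  rewrite /ew /edge_weight; apply: measurableT_comp => //.
  apply: measurable_funB; last first.
    by rewrite (_ : (fun w => _) = (fun w => U w + U w)); [exact: measurable_funD|apply/funext].
  by apply: measurableT_comp => //; apply: measurableT_comp => //; apply: measurable_funB;
      exact: mzX || exact: mzY.
have ms (P : {set 'I_N * 'I_N} -> Om -> bool) : (forall M, measurable_fun setT (P M)) ->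
    measurable_fun setT (fun w => \sum_(M | P M w) wt (ew N w) M).
  move=> mP; rewrite (_ : (fun w => _) = (fun w => \sum_(M <- index_enum _)
      (fun (M : {set 'I_N * 'I_N}) w => if P M w then wt (ew N w) M else 0) M w)); last first.
    by apply/funext => w; rewrite big_mkcond.
  apply: measurable_sum => M; apply: measurable_fun_ifT => //; exact: measurable_cst.
rewrite /rat /ratio; apply: measurable_funM.
  by apply: (ms (fun M w => matching (A0 N w) (B0 N w) M && (partner (fX N w) (fY N w) M == y
      w))) => M; exact: measurable_matching_partner.
rewrite (_ : (fun w => _) = (fun w => powR (\sum_(M | matching (A0 N w) (B0 N w) M) wt (ew N w)
    M) (-1))).
  apply: (measurableT_comp (measurable_powR _)).
  by apply: (ms (fun M w => matching (A0 N w) (B0 N w) M)) => M; exact: measurable_matching.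
apply/funext => w; rewrite powR_inv1 //.
by apply: sumr_ge0 => M _; apply: wt_ge0 => e; exact: edge_weight_ge0.
Qed.

(** A pointwise limit of sequences that are eventually constant in [N]: either [N] indices exhaust
    both windows, or no [N] does and the trivial value holds throughout. *)
Lemma measurable_gibbs_at0 : measurable_fun setT (fun w =>
  gibbs_at0 V (U w) (window K (points zX vX w)) (window K (points zY vY w)) (y w)).
Proof.
apply: (measurable_fun_cvg (h := fun N w => if `[< enough N w >] then rat N w else (y w ==
    None)%:R)).
  move=> N; apply: measurable_fun_ifT.
  - apply: measurable_asbool; apply: measurableI; exact: measurable_within_first.
  - exact: measurable_rat.
  - case: my => [yN|[g mg yS]].
      rewrite (_ : (fun w => _) = cst 1); [exact: measurable_cst|].
      by apply/funext => w; rewrite yN.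
    rewrite (_ : (fun w => _) = cst 0); [exact: measurable_cst|].
    by apply/funext => w; rewrite yS.
move=> w _; have [[N hN]|no] := pselect (exists N, enough N w).
  apply: cvg_near_cst; exists N => // m /= Nm.
  have hm : enough m w.
    by case: hN => h1 h2; split=> n mn; [apply: h1|apply: h2]; exact: leq_trans mn.
  by rewrite asboolT // (gibbs_enough m w).
rewrite (_ : (fun N => _) = cst (y w == None)%:R); last first.
  by apply/funext => N; rewrite asboolF // => h; apply: no; exists N.
rewrite gibbs_at0_trivial; first exact: cvg_cst.
apply: contrapT => /not_orP[hX hY]; apply: no.
have [NX hNX] : exists N, within_first zX vX K N w.
  apply/finite_windowP; apply: contrapT => inf; apply: hX.
  by rewrite /window /fset_set; case: pselect.
have [NY hNY] : exists N, within_first zY vY K N w.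
  apply/finite_windowP; apply: contrapT => inf; apply: hY.
  by rewrite /window /fset_set; case: pselect.
exists (maxn NX NY); split=> n; rewrite geq_max => /andP[n1 n2]; [exact: hNX|exact: hNY].
Qed.

End GibbsMeasurable.

(** * Moments of the point processes *)

Section Series.
Context {R : realType}.
Local Open Scope ereal_scope.

Lemma nneseries_ge_term (f : nat -> \bar R) k : (forall n, 0 <= f n) ->
  f k <= \sum_(n <oo) f n.
Proof.
move=> f0; rewrite (nneseriesD1 (n := k)) // leeDl //.
by apply: nneseries_ge0 => n _ _.
Qed.

Lemma nneseries_le (f : nat -> \bar R) x : (forall n, 0 <= f n) ->
  (forall N, \sum_(0 <= n < N) f n <= x) -> \sum_(n <oo) f n <= x.
Proof.
move=> f0 fx; apply: (lime_le (is_cvg_nneseries (fun n _ _ => f0 n))).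
exact: nearW.
Qed.

Lemma nneseries_EFin_exp (x : R) : (0 <= x)%R ->
  \sum_(k <oo) (exp_coeff x k)%:E = (expR x)%:E.
Proof.
move=> x0; rewrite /expR -EFin_lim; last exact: is_cvg_series_exp_coeff.
by apply/congr_lim/funext => n; rewrite /= /series /= -sumEFin.
Qed.

(** Comparison with the geometric series of ratio 1/2, since [expR 1 >= 2]. *)
Lemma nneseries_expN_le : \sum_(k <oo) (expR (- k%:R))%:E <= 2%:E :> \bar R.
Proof.
have h := @cvg_geometric_eseries_half R 2 0.
have hl := cvg_lim (@ereal_hausdorff R) h.
rewrite expr0 divr1 in hl; rewrite -hl.
apply: lee_nneseries => [k _ _|k _]; first by rewrite lee_fin expR_ge0.
rewrite lee_fin expRN addn1 expnS natrM invfM mulrA divff // mul1r.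
rewrite lef_pV2 ?posrE ?expR_gt0 ?ltr0n ?expn_gt0 //.
rewrite -[k%:R]mulr1 expRM_natl natrX lerXn2r ?nnegrE ?expR_ge0 //.
by apply: le_trans (expR_ge1Dx _).
Qed.

End Series.

Section Poisson.
Context {R : realType} {d : measure_display} {Om : measurableType d}.
Variable mu : {measure set Om -> \bar R}.
Local Open Scope ereal_scope.

Lemma poisson_prob_set1 (l : R) k : (0 <= l)%R ->
  poisson_prob l k [set k] = (expR (- l) * exp_coeff l k)%:E.
Proof.
rewrite /poisson_prob le_eqVlt => /orP[/eqP <-|l0].
  rewrite ltxx oppr0 expR0 mul1r /exp_coeff /= diracE.
  case: k => [|k]; first by rewrite expr0 fact0 divr1 mem_set.
  by rewrite expr0n /= mul0r memNset.
rewrite l0 esum_set1 ?lee_fin ?poisson_pmf_ge0 //.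
by rewrite /poisson_pmf l0 /exp_coeff mulrC.
Qed.

(** By injectivity the sum is at most the mean number of points in [B]. The crude bound [k <= 2 ^ k]
    turns the Poisson mean into an exponential series with sum [expR l]; any bound depending only on
    [rate] and [r] suffices. *)
Lemma PPP_intensity_le (rate r : R) (f : nat -> Om -> R) (B : set R) :
  (0 <= rate)%R -> (forall n, measurable_fun setT (f n)) ->
  (forall w, injective (f ^~ w)) ->
  is_PPP mu rate (fun w => range (f ^~ w)) ->
  mu setT = 1 ->
  measurable B -> lebesgue_measure B <= r%:E ->
  \sum_(n <oo) mu (f n @^-1` B) <= (expR (rate * r))%:E.
Proof.
move=> rate0 mf fi ppp mu1 mB Br.
have Bfin : lebesgue_measure B < +oo by apply: le_lt_trans Br _; rewrite ltry.
set m := fine (lebesgue_measure B).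
have m0 : (0 <= m)%R by rewrite fine_ge0.
have mr : (m <= r)%R by rewrite -lee_fin fineK // ge0_fin_numE.
pose l := (rate * m)%R; have l0 : (0 <= l)%R by rewrite mulr_ge0.
pose E k := [set w | (range (f ^~ w) `&` B #= `I_k)%card].
have [mE muE] : (forall k, measurable (E k)) /\
    (forall k, mu (E k) = (expR (- l) * exp_coeff l k)%:E).
  suff h k : measurable (E k) /\ mu (E k) = (expR (- l) * exp_coeff l k)%:E.
    by split=> k; have [] := h k.
  have := ppp 1%N (fun=> B) (fun=> k) (fun=> mB) (fun=> Bfin).
  have dis (i j : 'I_1) : i != j -> B `&` B = set0.
    by rewrite (ord1 i) (ord1 j) eqxx.
  move=> /(_ dis) /=; rewrite big_ord1 -/m poisson_prob_set1 // => -[h1 h2].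
  have EE : [set w | ('I_1 -> range (f ^~ w) `&` B #= `I_k)%card] = E k.
    by apply/seteqP; split=> w h => [|_]; [exact: (h ord0)|exact: h].
  by rewrite EE in h1 h2.
pose A n := f n @^-1` B.
have mA n : measurable (A n) by rewrite /A -[X in measurable X]setTI; exact: mf.
have Edisj : trivIset setT E.
  apply/trivIsetP => i j _ _ ij; apply/seteqP; split=> // w [h1 h2].
  have /card_eq_II ij' := card_eq_trans (card_esym h1) h2.
  by rewrite ij' eqxx in ij.
have Nle k w : E k w -> \sum_(n <oo) (\1_(A n) w)%:E <= k%:R%:E :> \bar R.
  move=> Ek; apply: (nneseries_le (fun n => (\1_(A n) w)%:E)) => [n|N]; first by rewrite lee_fin.
  rewrite sumEFin lee_fin.
  have -> : (\sum_(0 <= n < N) \1_(A n) w)%R = (count (fun n => `[< A n w >]) (iota 0 N))%:R :> R.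
    rewrite -sum1_count natr_sum [RHS]big_mkcond /index_iota subn0; apply: eq_bigr => n _.
    by rewrite indicE; case: asboolP => h; [rewrite mem_set|rewrite memNset].
  rewrite ler_nat -size_filter.
  pose s := [seq n <- iota 0 N | `[< A n w >]]; rewrite -/s.
  have us : uniq [seq f n w | n <- s] by rewrite map_inj_uniq ?filter_uniq ?iota_uniq.
  have fin : finite_set (range (f ^~ w) `&` B) by apply/finite_setP; exists k.
  rewrite -(card_fset_set Ek) -(size_map (f ^~ w)); apply: uniq_leq_size => // r0 /mapP[n].
  rewrite mem_filter => /andP[/asboolP An _] ->.
  by rewrite in_fset_set // inE; split => //; exists n.
pose N w : \bar R := \sum_(n <oo) (\1_(A n) w)%:E.
pose H w : \bar R := \sum_(k <oo) (k%:R%:E * (\1_(E k) w)%:E).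
have ind0 (D : set Om) w : 0 <= (\1_D w)%:E :> \bar R by rewrite lee_fin.
have mind (D : set Om) : measurable D -> measurable_fun setT (fun w => (\1_D w)%:E : \bar R).
  by move=> mD; apply/measurable_EFinP; exact: measurable_indic.
have kind k w : 0 <= k%:R%:E * (\1_(E k) w)%:E :> \bar R by rewrite mule_ge0 // lee_fin.
have mkind k : measurable_fun setT (fun w => k%:R%:E * (\1_(E k) w)%:E : \bar R).
  by apply/measurable_EFinP/measurable_funM => //; exact: measurable_indic.
have NE : \int[mu]_w N w = \sum_(n <oo) mu (A n).
  rewrite integral_nneseries //; last by move=> n; exact: mind.
  by apply: eq_eseriesr => n _; rewrite integral_indic // setIT.
have HE : \int[mu]_w H w = \sum_(k <oo) (k%:R%:E * mu (E k)).
  rewrite integral_nneseries //; apply: eq_eseriesr => k _.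
  rewrite ge0_integralZl ?lee_fin // ?integral_indic ?setIT //; exact: mind.
(* The Poisson masses add up to 1, so the outcomes with infinitely many points in [B] are
   negligible. *)
have mEU : mu (\bigcup_k E k) = 1.
  rewrite measure_bigcup //.
  under eq_eseriesr do rewrite muE EFinM.
  rewrite (eq_eseriesl (Q := xpredT)) => [|k]; last by rewrite in_setT.
  rewrite nneseriesZl => [|k _]; last by rewrite lee_fin exp_coeff_ge0.
  by rewrite nneseries_EFin_exp // -EFinM -expRD addNr expR0.
rewrite -NE; apply: (@le_trans _ _ (\int[mu]_w H w)).
  apply: ae_ge0_le_integral => //.
  - by move=> w _; apply: nneseries_ge0.
  - apply: ge0_emeasurable_sum => // k _; exact: mind.
  - by move=> w _; apply: nneseries_ge0.
  - by apply: ge0_emeasurable_sum.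
  exists (~` \bigcup_k E k); split.
  - by apply: measurableC; exact: bigcupT_measurable.
  - rewrite -setTD measureD //; last 2 first.
    + exact: bigcupT_measurable.
    + by rewrite [X in X < _]mu1 ltry.
    by rewrite setTI [X in X - _]mu1 [X in _ - X]mEU subee.
  move=> w /= nle [k _ Ek]; apply: nle => _.
  apply: le_trans (Nle k w Ek) _; apply: le_trans (nneseries_ge_term _ k _) => //.
  by rewrite indicE mem_set // mule1.
rewrite HE; apply: (@le_trans _ _ (\sum_(k <oo) (expR (- l))%:E * (exp_coeff (2 * l) k)%:E)).
  apply: lee_nneseries => [k _ _|k _]; first by rewrite mule_ge0.
  rewrite muE -!EFinM lee_fin mulrCA ler_pM2l ?expR_gt0 //.
  rewrite /exp_coeff /= [((2 * l) ^+ k)%R]exprMn mulrA ler_wpM2r ?invr_ge0 // ler_wpM2r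
      ?exprn_ge0 //.
  by rewrite -natrX ler_nat; exact/ltnW/ltn_expl.
rewrite nneseriesZl => [|k _]; last by rewrite lee_fin exp_coeff_ge0 ?mulr_ge0.
rewrite nneseries_EFin_exp ?mulr_ge0 // -EFinM -expRD lee_fin ler_expR.
have -> : (- l + 2 * l = l)%R by ring.
by rewrite ler_wpM2l.
Qed.
End Poisson.

(** * Unit shells and the tail of the displacement law *)

Section Shells.
Context {R : realType}.

Definition shell (a : R) (k : nat) : set R :=
  `[a + k%:R, a + k%:R + 1] `|` `[a - k%:R - 1, a - k%:R].

Lemma measurable_shell a k : measurable (shell a k).
Proof. by apply: measurableU; exact: measurable_itv. Qed.

Lemma shell_dist a k y : shell a k y -> k%:R <= `|y - a| <= k%:R + 1.
Proof.
have k0 : (0 : R) <= k%:R by [].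
case=> /=; rewrite in_itv /= => /andP[h1 h2].
  rewrite ger0_norm; [apply/andP; split; lra|lra].
rewrite ler0_norm; [apply/andP; split; lra|lra].
Qed.

Lemma in_shell a y : shell a (Num.truncn `|y - a|) y.
Proof.
have /andP[] := Num.Theory.truncn_itv (normr_ge0 (y - a)).
set k := Num.truncn _; rewrite -natr1 => h1 h2.
have k0 : (0 : R) <= k%:R by [].
have [ya|ya] := leP 0 (y - a).
  by left => /=; move: h1 h2; rewrite ger0_norm // in_itv /=; lra.
by right => /=; move: h1 h2; rewrite ltr0_norm // in_itv /=; lra.
Qed.

Lemma lebesgue_shell a k : (lebesgue_measure (shell a k) <= 2%:E)%E.
Proof.
have unit_itv (u v : R) : v = u + 1 -> lebesgue_measure `[u, v] = 1%E.
  move=> ->; rewrite lebesgue_measure_itv /= lte_fin ltrDl ltr01 -EFinD.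
  by congr EFin; ring.
apply: le_trans (measureU2 _ _ _) _; try exact: measurable_itv.
apply: (@le_trans _ _ (1 + 1)%E); last by rewrite -EFinD lee_fin; lra.
apply: leeD; rewrite le_eqVlt; apply/orP; left; apply/eqP; apply: unit_itv => //.
by rewrite subrK.
Qed.

Lemma peak_le (t y : R) : 0 <= t ->
  peak t y <= expR (- `|y - t|) + expR (- `|y - - t|).
Proof.
move=> t0; rewrite /peak opprK; have [y0|y0] := leP 0 y.
  by rewrite (ger0_norm y0) lerDl expR_ge0.
by rewrite (ltr0_norm y0) -opprD normrN lerDr expR_ge0.
Qed.

(** Superlinear growth beats the slope 2 beyond [A = (2 / c0) ^ (1 / del)], where
    [c0 * A ^ del = 2]; below [A] the constant [2 * A] absorbs the difference. Slope 2 leaves a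
    summable factor once the [expR l] of [sum_exp_dist_le] is paid. *)
Lemma potential_tail (V : R -> R) : potential_assumption V ->
  exists2 C : R, 0 < C & forall t, expR (- V t) <= C * expR (- (2 * `|t|)).
Proof.
move=> [_ _ _ [C0 [c0 [del [Vmin [f [g [[C0p c0p delp] _ _ h]]]]]]]].
pose A := (2 / c0) `^ del^-1.
exists (expR (2 * A - Vmin)); first exact: expR_gt0.
move=> t; rewrite -expRD ler_expR.
have [_ _ h1 h2] := h t.
have V1 : c0 * `|t| `^ (1 + del) <= V t - Vmin by exact: le_trans h1.
have A0 : 0 <= A by exact: powR_ge0.
suff : 2 * `|t| - 2 * A <= c0 * `|t| `^ (1 + del) by move: V1; lra.
have [tA|At] := leP `|t| A.
  apply: (@le_trans _ _ 0); first by move: tA; lra.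
  by rewrite mulr_ge0 ?powR_ge0 // ltW.
have t0 : 0 < `|t| by exact: le_lt_trans At.
apply: (@le_trans _ _ (2 * `|t|)); first by move: A0; lra.
rewrite powRD; last by rewrite (gt_eqF t0) implybT.
rewrite powRr1 // mulrCA [X in _ <= X]mulrC ler_wpM2r //.
rewrite -ler_pdivrMl // mulrC.
have -> : 2 / c0 = A `^ del.
  by rewrite /A -powRrM mulVf ?gt_eqF // powRr1 // divr_ge0 // ltW.
by apply: ge0_ler_powR; rewrite ?nnegrE; exact: ltW || exact: A0 || by rewrite ltW.
Qed.

End Shells.

Section Moments.
Context {R : realType} {d : measure_display} {Om : measurableType d}.
Variable mu : {measure set Om -> \bar R}.
Local Open Scope ereal_scope.

(** If [f n] is in the k-th shell around [a] and [g n] in the l-th around 0, then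
    [|f + g - a| >= k - (l + 1)]. By independence the term is at most [expR (- k) * expR (l + 1)]
    times a product of probabilities. The sums over [k] and over [l] each cost a factor 2 by
    [nneseries_expN_le], which gives [4 * expR 1]. *)
Lemma sum_exp_dist_le (f g : nat -> Om -> R) (c0 c1 a : R) :
  mu setT = 1 -> (0 <= c0)%R -> (0 <= c1)%R ->
  (forall n, measurable_fun setT (f n)) -> (forall n, measurable_fun setT (g n)) ->
  (forall n (A B : set R), measurable A -> measurable B ->
    mu (f n @^-1` A `&` g n @^-1` B) = mu (f n @^-1` A) * mu (g n @^-1` B)) ->
  (forall k, \sum_(n <oo) mu (f n @^-1` shell a k) <= c0%:E) ->
  (forall n l, mu (g n @^-1` shell 0 l) <= (c1 * expR (- (2 * l%:R)))%:E) ->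
  \sum_(n <oo) \int[mu]_w (expR (- `|f n w + g n w - a|))%:E <=
    (4 * expR 1 * c0 * c1)%:E.
Proof.
move=> mu1 c00 c10 mf mg indep fshell gshell.
pose A n k := f n @^-1` shell a k; pose B n l := g n @^-1` shell 0 l.
have mA n k : measurable (A n k).
  by rewrite /A -[X in measurable X]setTI; apply: mf => //; exact: measurable_shell.
have mB n l : measurable (B n l).
  by rewrite /B -[X in measurable X]setTI; apply: mg => //; exact: measurable_shell.
have mAB n k l : measurable (A n k `&` B n l) by exact: measurableI.
pose u k : R := expR (- k%:R); pose v l : R := expR (l%:R + 1).
have u0 k : (0 <= u k)%R by exact: expR_ge0.
have v0 l : (0 <= v l)%R by exact: expR_ge0.
pose term n k l w : \bar R := (u k * v l)%:E * (\1_(A n k `&` B n l) w)%:E.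
have term0 n k l w : 0 <= term n k l w.
  by rewrite /term mule_ge0 // lee_fin ?mulr_ge0.
have mterm n k l : measurable_fun setT (term n k l).
  by apply/measurable_EFinP/measurable_funM => //; exact: measurable_indic.
have mterms n k : measurable_fun setT (fun w => \sum_(l <oo) term n k l w).
  by apply: ge0_emeasurable_sum.
have terms0 n k w : 0 <= \sum_(l <oo) term n k l w by apply: nneseries_ge0.
have int_term n k l : \int[mu]_w term n k l w = (u k)%:E * ((v l)%:E * (mu (A n k) * mu (B n l))).
  rewrite /term ge0_integralZl ?lee_fin ?mulr_ge0 //; last first.
    by apply/measurable_EFinP; exact: measurable_indic.
  by rewrite integral_indic // setIT indep ?EFinM ?muleA //; exact: measurable_shell.
have int_le n : \int[mu]_w (expR (- `|f n w + g n w - a|))%:E <=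
    \sum_(k <oo) (u k)%:E * ((2 * expR 1 * c1)%:E * mu (A n k)).
  apply: (@le_trans _ _ (\int[mu]_w \sum_(k <oo) \sum_(l <oo) term n k l w)).
    apply: ge0_le_integral => //.
    - apply/measurable_EFinP; apply: measurableT_comp => //; apply: measurableT_comp => //.
      apply: measurableT_comp => //; apply: measurable_funB => //; exact: measurable_funD.
    - by apply: ge0_emeasurable_sum.
    move=> w _.
    pose k := Num.truncn `|f n w - a|%R; pose l := Num.truncn `|g n w - 0|%R.
    apply: le_trans (nneseries_ge_term _ k _) => //.
    apply: le_trans (nneseries_ge_term _ l _) => //.
    have Ak : A n k w by exact: in_shell.
    have Bl : B n l w by exact: in_shell.
    rewrite /term indicE mem_set // mule1 lee_fin -expRD ler_expR.
    have /andP[h1 _] := shell_dist _ _ _ Ak.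
    have /andP[_ h2] := shell_dist _ _ _ Bl.
    rewrite subr0 in h2.
    have : (`|f n w - a| <= `|f n w + g n w - a| + `|g n w|)%R.
      have -> : (f n w - a = (f n w + g n w - a) - g n w)%R by ring.
      exact: ler_normB.
    by move: h1 h2; lra.
  rewrite integral_nneseries //; apply: lee_nneseries => [k _ _|k _].
    by apply: integral_ge0.
  rewrite integral_nneseries //; under eq_eseriesr do rewrite int_term.
  rewrite nneseriesZl => [|l _]; last by rewrite !mule_ge0 // lee_fin.
  rewrite lee_wpmul2l // ?lee_fin //.
  apply: (@le_trans _ _ (\sum_(l <oo) (expR 1 * c1)%:E * mu (A n k) * (u l)%:E)).
    apply: lee_nneseries => [l _ _|l _]; first by rewrite !mule_ge0 // lee_fin.
    rewrite muleCA -[leRHS]muleA [leRHS]muleCA lee_wpmul2l //.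
    apply: le_trans (lee_wpmul2l _ (gshell n l)) _; first by rewrite lee_fin.
    rewrite -!EFinM lee_fin /v /u mulrCA -expRD [leRHS]mulrAC -expRD mulrC.
    by rewrite ler_wpM2r // ler_expR; lra.
  have fA : mu (A n k) \is a fin_num.
    rewrite ge0_fin_numE //; apply: (@le_lt_trans _ _ (mu setT)); first by apply: le_measure;
        rewrite ?inE.
    by rewrite [X in X < _]mu1 ltry.
  rewrite -(fineK fA) -EFinM nneseriesZl => [|l _]; last by rewrite lee_fin.
  have -> : (2 * expR 1 * c1)%:E * (fine (mu (A n k)))%:E =
      (expR 1 * c1 * fine (mu (A n k)))%:E * 2%:E.
    by rewrite -!EFinM; congr EFin; ring.
  apply: lee_wpmul2l; last exact: nneseries_expN_le.
  by rewrite lee_fin !mulr_ge0 ?expR_ge0 // fine_ge0.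
have c2 : (0 <= 2 * expR 1 * c1)%R by rewrite !mulr_ge0 ?expR_ge0.
apply: le_trans (lee_nneseries _ (fun n _ => int_le n)) _.
  by move=> n _ _; apply: integral_ge0 => w _; rewrite lee_fin expR_ge0.
rewrite nneseries_interchange; last by move=> n k; rewrite !mule_ge0 // lee_fin.
apply: (@le_trans _ _ (\sum_(k <oo) (2 * expR 1 * c1 * c0)%:E * (u k)%:E)).
  apply: lee_nneseries => [k _ _|k _].
    by apply: nneseries_ge0 => n _ _; rewrite !mule_ge0 // lee_fin.
  rewrite nneseriesZl => [|n _]; last by rewrite mule_ge0 // lee_fin.
  rewrite nneseriesZl //.
  rewrite [leRHS]muleC; apply: lee_wpmul2l; first by rewrite lee_fin.
  rewrite [leRHS]EFinM; apply: lee_wpmul2l; first by rewrite lee_fin.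
  exact: fshell.
rewrite nneseriesZl => [|k _]; last by rewrite lee_fin.
have -> : (4 * expR 1 * c0 * c1)%:E = (2 * expR 1 * c1 * c0)%:E * 2%:E.
  by rewrite -EFinM; congr EFin; ring.
apply: lee_wpmul2l; last exact: nneseries_expN_le.
by rewrite lee_fin mulr_ge0.
Qed.

End Moments.

Section Liminf.
Context {R : realType}.
Local Open Scope ereal_scope.

Lemma limn_einfE (u : nat -> \bar R) : limn_einf u = ereal_sup (range (einfs u)).
Proof. by rewrite limn_einf_lim; apply/cvg_lim => //; exact: cvg_einfs_sup. Qed.

Lemma limn_einf_le (u : nat -> \bar R) m : (forall n, u n <= m) -> limn_einf u <= m.
Proof.
move=> um; rewrite limn_einfE; apply: ge_ereal_sup => _ [n _ <-].
by apply: le_trans (um n); apply: ereal_inf_lbound; exists n => /=.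
Qed.

(** Supplies arbitrarily distant boundaries with one common bound [M]. *)
Lemma limn_einf_lty (u : nat -> \bar R) : limn_einf u < +oo ->
  exists M : R, forall T0, exists2 n, (T0 <= n)%N & u n <= M%:E.
Proof.
move=> ulty; have [M uM] : exists M : R, limn_einf u < M%:E.
  case: (limn_einf u) ulty => [r _| //|_].
    by exists (r + 1)%R; rewrite lte_fin ltrDl.
  by exists 0%R; rewrite ltNyr.
exists M => T0; have h : einfs u T0 < M%:E.
  apply: le_lt_trans uM; rewrite limn_einfE.
  by apply: ereal_sup_ubound; exists T0.
have /ereal_inf_lt[_ [n /= Tn <-] unM] := h.
by exists n => //; exact: ltW.
Qed.

Lemma measurable_limn_einf {d} {T : measurableType d} (u : nat -> T -> \bar R) :
  (forall n, measurable_fun setT (u n)) ->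
  measurable_fun setT (fun x => limn_einf (u ^~ x)).
Proof.
move=> mu; apply: measurableT_comp => //.
by apply: measurable_fun_limn_esup => n; exact: measurableT_comp.
Qed.

End Liminf.

(** * Tightness of the peak sums *)

Section PeakSum.
Context {R : realType} {d : measure_display} {Om : measurableType d}.
Variables (p : R) (V : R -> R).
Variables (xi eta : nat -> {mfun Om >-> R}).
Variables (b : nat -> {mfun Om >-> bool}) (e : nat -> {mfun Om >-> R}).
Local Open Scope ereal_scope.

Definition series_peak (f : nat -> Om -> R) (t : R) (w : Om) : \bar R :=
  \sum_(n <oo) (peak t (f n w))%:E.

(** The index shift matches [Xpt n.+1 = xi n]. Images are summed over all points, whether or not
    they lie in the domain, which only enlarges the sum. The origin and its image are left out, as
    each contributes at most 1. *)
Definition peak_sum (t : R) (w : Om) : \bar R :=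
  series_peak (fun n => xi n) t w + series_peak (fun n => eta n) t w +
  series_peak (fun n w => xi n w + e n.+1 w)%R t w.

Lemma measurable_peak (t : R) (f : Om -> R) : measurable_fun setT f ->
  measurable_fun setT (fun w => (peak t (f w))%:E).
Proof.
move=> mf; apply/measurable_EFinP; apply: measurableT_comp => //.
apply: measurableT_comp => //; apply: measurableT_comp => //.
by apply: measurableT_comp => //; exact: measurable_funB.
Qed.

Lemma measurable_series_peak (f : nat -> Om -> R) t :
  (forall n, measurable_fun setT (f n)) -> measurable_fun setT (series_peak f t).
Proof.
move=> mf; apply: ge0_emeasurable_sum => [n w _ _|n _]; first by rewrite lee_fin peak_ge0.
exact: measurable_peak.
Qed.

Lemma series_peak_ge0 f t w : 0 <= series_peak f t w.
Proof. by apply: nneseries_ge0 => n _ _; rewrite lee_fin peak_ge0. Qed.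

Lemma measurable_shifted n : measurable_fun setT (fun w => xi n w + e n.+1 w)%R.
Proof. exact: measurable_funD. Qed.

Lemma measurable_peak_sum t : measurable_fun setT (peak_sum t).
Proof.
apply: emeasurable_funD; first apply: emeasurable_funD; apply: measurable_series_peak => n //.
exact: measurable_shifted.
Qed.

Lemma peak_sum_ge0 t w : 0 <= peak_sum t w.
Proof. by rewrite !adde_ge0 ?series_peak_ge0. Qed.

Variable mu : {measure set Om -> \bar R}.

(** The first factor 2 comes from the two centres [t] and [- t] in [peak_le]. With [g = 0] this
    covers the points themselves, with [g] the displacement it covers their images. *)
Lemma int_series_peak_le (f g : nat -> Om -> R) (c0 c1 : R) (t : R) :
  mu setT = 1 -> (0 <= t)%R -> (0 <= c0)%R -> (0 <= c1)%R ->
  (forall n, measurable_fun setT (f n)) -> (forall n, measurable_fun setT (g n)) ->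
  (forall n (A B : set R), measurable A -> measurable B ->
    mu (f n @^-1` A `&` g n @^-1` B) = mu (f n @^-1` A) * mu (g n @^-1` B)) ->
  (forall a k, \sum_(n <oo) mu (f n @^-1` shell a k) <= c0%:E) ->
  (forall n l, mu (g n @^-1` shell 0 l) <= (c1 * expR (- (2 * l%:R)))%:E) ->
  \int[mu]_w series_peak (fun n w => f n w + g n w)%R t w <=
    (2 * (4 * expR 1 * c0 * c1))%:E.
Proof.
move=> mu1 t0 c00 c10 mf mg indep fs gs.
have mfg n : measurable_fun setT (fun w => f n w + g n w)%R by exact: measurable_funD.
have mh a n : measurable_fun setT (fun w => (expR (- `|f n w + g n w - a|))%:E : \bar R).
  apply/measurable_EFinP; apply: measurableT_comp => //; apply: measurableT_comp => //.
  by apply: measurableT_comp => //; apply: measurable_funB.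
have bnd a := sum_exp_dist_le mu f g c0 c1 a mu1 c00 c10 mf mg indep (fs a) gs.
rewrite integral_nneseries //; last 2 first.
- by move=> n; exact: measurable_peak.
- by move=> n w _; rewrite lee_fin peak_ge0.
apply: (@le_trans _ _ (\sum_(n <oo) (\int[mu]_w (expR (- `|f n w + g n w - t|))%:E +
    \int[mu]_w (expR (- `|f n w + g n w - - t|))%:E))).
  apply: lee_nneseries => [n _ _|n _].
    by apply: integral_ge0 => w _; rewrite lee_fin peak_ge0.
  rewrite -ge0_integralD //; try by move=> w _; rewrite lee_fin expR_ge0.
  apply: ge0_le_integral => //.
  - by move=> w _; rewrite lee_fin peak_ge0.
  - exact: measurable_peak.
  - exact: emeasurable_funD.
  by move=> w _; rewrite -EFinD lee_fin peak_le.
rewrite nneseriesD; last 2 first.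
- by move=> n _ _; apply: integral_ge0 => w _; rewrite lee_fin expR_ge0.
- by move=> n _ _; apply: integral_ge0 => w _; rewrite lee_fin expR_ge0.
by rewrite mulrDl mul1r EFinD; apply: leeD; exact: bnd.
Qed.

Lemma sources_indep (n : nat) (A B : set R) :
  mutually_independent mu (sources xi eta b e) -> measurable A -> measurable B ->
  mu (xi n @^-1` A `&` e n.+1 @^-1` B) = mu (xi n @^-1` A) * mu (e n.+1 @^-1` B).
Proof.
move=> ind mA mB.
pose i1 : bool + (nat + nat) := inl true.
pose i2 : bool + (nat + nat) := inr (inr n.+1).
pose E i := if i == i1 then xi n @^-1` A else e n.+1 @^-1` B.
have := ind [fset i1; i2]%fset E.
have -> : \bigcap_(i in [set` [fset i1; i2]%fset]) E i = xi n @^-1` A `&` e n.+1 @^-1` B.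
  apply/seteqP; split=> [w h|w [h1 h2] i /=].
    by split; [have := h i1; rewrite /= !inE eqxx => /(_ isT)|
               have := h i2; rewrite /= !inE eqxx orbT => /(_ isT)].
  by rewrite !inE /E => /orP[/eqP ->|/eqP ->].
rewrite big_fsetU1 ?inE //= big_seq_fset1 /E /=; apply.
move=> i; rewrite !inE => /orP[/eqP ->|/eqP ->] /=; last by exists B => //; rewrite setTI.
apply: sub_sigma_algebra; exists n => //; exists A => //; by rewrite setTI.
Qed.

Lemma int_peak_sum_le l : (0 < p < 1)%R -> (0 <= l)%R -> potential_assumption V ->
  (forall w, injective (xi ^~ w)) -> (forall w, injective (eta ^~ w)) ->
  conditional_construction p V xi eta b e mu l ->
  exists m : R, forall t, (0 <= t)%R -> \int[mu]_w peak_sum t w <= m%:E.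
Proof.
move=> /andP[p0 p1] l0 hV xinj einj [pppX _ law pppY ind].
have [C C0 VC] := potential_tail V hV.
(* [is_PPP] for the empty family of test sets: the event is everything and the product is empty. *)
have mu1 : mu setT = 1.
  have := pppX 0%N (fun=> set0) (fun=> 0%N) (fun=> measurable0).
  rewrite measure0 => /(_ (fun=> ltry 0)) /(_ (fun i => match i with Ordinal _ h => _ end)).
  by move=> /(_ ltac:(by case))[_]; rewrite big_ord0 => <-; congr (mu _); apply/seteqP; split
      => // w _ [].
have q0 : (0 < 1 - p)%R by rewrite subr_gt0.
set rX := (l * p / (1 - p) ^+ 2)%R in pppX.
set rY := (l * p / (1 - p))%R in pppY.
have rX0 : (0 <= rX)%R by rewrite divr_ge0 ?exprn_ge0 ?mulr_ge0 // ltW.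
have rY0 : (0 <= rY)%R by rewrite divr_ge0 ?mulr_ge0 // ltW.
have bX a k : \sum_(n <oo) mu (xi n @^-1` shell a k) <= (expR (rX * 2))%:E.
  by apply: PPP_intensity_le => //; [exact: measurable_shell|exact: lebesgue_shell].
have bY a k : \sum_(n <oo) mu (eta n @^-1` shell a k) <= (expR (rY * 2))%:E.
  by apply: PPP_intensity_le => //; [exact: measurable_shell|exact: lebesgue_shell].
have be n j : mu (e n @^-1` shell 0 j) <= (2 * C * expR (- (2 * j%:R)))%:E.
  have ms := measurable_shell (0 : R) j.
  have [mV _ _ _] := hV.
  rewrite law //.
  apply: (@le_trans _ _ (\int[lebesgue_measure]_(t in shell 0 j)
      cst (C * expR (- (2 * j%:R)))%:E t)).
    apply: ge0_le_integral => //.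
    - apply/measurable_EFinP; apply: measurable_funTS; apply: measurableT_comp => //.
      exact: measurableT_comp.
    move=> t st; rewrite lee_fin; apply: le_trans (VC t) _.
    rewrite ler_pM2l // ler_expR lerN2 ler_pM2l //.
    by have := shell_dist _ _ _ st; rewrite subr0 => /andP[].
  rewrite integral_cst //.
  have -> : (2 * C * expR (- (2 * j%:R)))%:E = (C * expR (- (2 * j%:R)))%:E * 2%:E.
    by rewrite -EFinM; congr EFin; ring.
  apply: lee_wpmul2l; last exact: lebesgue_shell.
  by rewrite lee_fin mulr_ge0 ?expR_ge0 // ltW.
(* The zero displacement satisfies the tail bound with constant 1, because 0 lies in [shell 0 0]
   only. *)
have b0 (n : nat) j : mu ((fun _ : Om => 0%R : R) @^-1` shell 0 j) <= (1 * expR (- (2 * j%:R)))%:E.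
  case: j => [|j].
    by rewrite mulr0 oppr0 expR0 mulr1 -mu1; apply: le_measure; rewrite ?inE //;
       rewrite -[X in measurable X]setTI; apply: measurable_cst => //; exact: measurable_shell.
  rewrite (_ : _ @^-1` _ = set0) ?measure0 ?lee_fin ?mulr_ge0 ?expR_ge0 //.
  apply/seteqP; split => // w /shell_dist; rewrite subrr normr0 => /andP[+ _].
  by rewrite lern0.
have i0 (f : nat -> Om -> R) n (A B : set R) : measurable_fun setT (f n) ->
    measurable A -> measurable B ->
    mu (f n @^-1` A `&` (fun _ : Om => 0%R : R) @^-1` B) = mu (f n @^-1` A) * mu ((fun _ : Om
        => 0%R : R) @^-1` B).
  move=> mf mA mB; have [B0|B0] := pselect (B 0%R).
    rewrite (_ : (fun _ : Om => 0%R : R) @^-1` B = setT); last by apply/seteqP; split.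
    by rewrite setIT [X in _ * X]mu1 mule1.
  rewrite (_ : (fun _ : Om => 0%R : R) @^-1` B = set0); last by apply/seteqP; split.
  by rewrite setI0 measure0 mule0.
pose c := (2 * (4 * expR 1 * expR (rX * 2) * 1) + 2 * (4 * expR 1 * expR (rY * 2) * 1) +
  2 * (4 * expR 1 * expR (rX * 2) * (2 * C)))%R.
exists c => t t0.
have ms f : (forall n, measurable_fun setT (f n)) -> measurable_fun setT (series_peak f t).
  exact: measurable_series_peak.
have single (f : nat -> Om -> R) (c0 : R) : (0 <= c0)%R ->
    (forall n, measurable_fun setT (f n)) ->
    (forall a k, \sum_(n <oo) mu (f n @^-1` shell a k) <= c0%:E) ->
    \int[mu]_w series_peak f t w <= (2 * (4 * expR 1 * c0 * 1))%:E.
  move=> c00 mf bf; apply: le_trans (int_series_peak_le f (fun _ _ => 0%R)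
    c0 1 t mu1 t0 c00 ler01 mf _ _ bf b0) => //.
    rewrite le_eqVlt; apply/orP; left; apply/eqP; apply: eq_integral => w _.
    by apply: eq_eseriesr => n _; rewrite addr0.
  by move=> n A B; apply: i0.
have hX := single (fun n => xi n) _ (expR_ge0 _) (fun n => measurable_funPT (xi n)) bX.
have hY := single (fun n => eta n) _ (expR_ge0 _) (fun n => measurable_funPT (eta n)) bY.
have hE : \int[mu]_w series_peak (fun n w => xi n w + e n.+1 w)%R t w <= (2 * (4 * expR 1 *
    expR (rX * 2) * (2 * C)))%:E.
  apply: (int_series_peak_le (fun n => xi n) (fun n => e n.+1)) => //.
  - by rewrite mulr_ge0 // ltW.
  - by move=> n A B; exact: sources_indep.
rewrite ge0_integralD //.
- rewrite ge0_integralD //; try by move=> w _; exact: series_peak_ge0.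
    by rewrite /c !EFinD; apply: leeD => //; apply: leeD.
  + by apply: ms => n.
  + by apply: ms => n.
- by move=> w _; rewrite adde_ge0 // series_peak_ge0.
- by apply: emeasurable_funD; apply: ms => n.
- by move=> w _; exact: series_peak_ge0.
- by apply: ms => n; exact: measurable_shifted.
Qed.

Definition tight (w : Om) : Prop := limn_einf (fun n => peak_sum n%:R w) < +oo.

Lemma measurable_tight : measurable [set w | tight w].
Proof.
have := measurable_limn_einf (fun n => peak_sum n%:R) (fun n => measurable_peak_sum n%:R).
by move=> /(emeasurable_fun_infty_o measurableT)/(_ +oo); rewrite setTI.
Qed.

Lemma tight_full l : (0 < p < 1)%R -> (0 <= l)%R -> potential_assumption V ->
  (forall w, injective (xi ^~ w)) -> (forall w, injective (eta ^~ w)) ->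
  conditional_construction p V xi eta b e mu l ->
  mu (~` [set w | tight w]) = 0.
Proof.
move=> hp l0 hV xinj einj hc.
have [m hm] := int_peak_sum_le l hp l0 hV xinj einj hc.
pose L w := limn_einf (fun n => peak_sum n%:R w).
have L0 w : 0 <= L w.
  rewrite /L limn_einfE; apply: (@le_trans _ _ (einfs (fun n => peak_sum n%:R w) 0%N)).
    by apply: le_ereal_inf_tmp => _ [k _ <-]; exact: peak_sum_ge0.
  by apply: ereal_sup_ubound; exists 0%N.
have mL : measurable_fun setT L.
  exact: measurable_limn_einf (fun n => measurable_peak_sum n%:R).
have intL : \int[mu]_w L w <= m%:E.
  apply: le_trans (fatou _ _ _ _) _ => //.
  - by move=> n; exact: measurable_peak_sum.
  - by move=> n w _; exact: peak_sum_ge0.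
  by apply: limn_einf_le => n; exact: hm.
have iL : mu.-integrable setT L.
  apply/integrableP; split => //.
  under eq_integral do rewrite gee0_abs //.
  exact: le_lt_trans intL (ltry m).
have [N [mN N0 sub]] := integrable_ae measurableT iL.
apply: (subset_measure0 _ mN) => //; first by apply: measurableC; exact: measurable_tight.
move=> w nt; apply: sub => /= /(_ I) fin; apply: nt.
by rewrite /= /tight -ge0_fin_numE //; exact: L0.
Qed.

End PeakSum.

(** * The limit law *)

Section EsumMisc.
Context {R : realType}.
Local Open Scope ereal_scope.

Lemma esum_subset (T : choiceType) (A B : set T) (a : T -> \bar R) :
  A `<=` B -> \esum_(i in A) a i <= \esum_(i in B) a i.
Proof.
move=> AB; apply: ge_ereal_sup => _ [X [finX XA] <-].
by apply: esum_ge; exists X => //; split => //; exact: subset_trans AB.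
Qed.

Lemma sum_le_esum (T : choiceType) (A : set T) (a : T -> \bar R) (s : seq T) :
  uniq s -> (forall i, i \in s -> A i) -> \sum_(i <- s) a i <= \esum_(i in A) a i.
Proof.
move=> us sA; apply: esum_ge; exists [set` s]; first by split => //; exact: finite_seq.
by rewrite fsbig_seq.
Qed.

Lemma esum_le_sum (T : choiceType) (A : set T) (a : T -> \bar R) x :
  (forall s : seq T, uniq s -> (forall i, i \in s -> A i) -> \sum_(i <- s) a i <= x) ->
  \esum_(i in A) a i <= x.
Proof.
move=> h; apply: ge_ereal_sup => _ [X [finX XA] <-].
rewrite fsbig_finite //; apply: h => [|i]; first exact: fset_uniq.
by rewrite in_fset_set // => /set_mem/XA.
Qed.

Lemma esum_setU_le (T : choiceType) (A B : set T) (a : T -> \bar R) :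
  (forall i, 0 <= a i) ->
  \esum_(i in A `|` B) a i <= \esum_(i in A) a i + \esum_(i in B) a i.
Proof.
move=> a0; rewrite esum_mkcond (esum_mkcond A) (esum_mkcond B) -esumD; last 2 first.
- by move=> i _; case: ifP.
- by move=> i _; case: ifP.
apply: le_esum => i _; rewrite in_setU.
by case: (i \in A); case: (i \in B) => //=; rewrite ?adde0 ?add0e // leeDl.
Qed.

Lemma is_pmf_approx (T : choiceType) (S : set T) (Q : T -> R) :
  (forall j, (0 <= Q j)%R) -> (forall j, ~ S j -> Q j = 0%R) ->
  (forall s : seq T, uniq s -> (\sum_(j <- s) Q j <= 1)%R) ->
  (forall eps, (0 < eps)%R -> exists s : seq T, [/\ uniq s, (forall j, j \in s -> S j) &
     (1 - eps <= \sum_(j <- s) Q j)%R]) ->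
  is_pmf S Q.
Proof.
move=> Q0 QS Qle Qge; split => //; apply/eqP; rewrite eq_le; apply/andP; split.
  by apply: esum_le_sum => s us _; rewrite sumEFin lee_fin; exact: Qle.
apply/lee_addgt0Pr => eps eps0; have [s [us sS h]] := Qge eps eps0.
rewrite -leeBlDr //; apply: le_trans (sum_le_esum _ _ _ s us sS).
by rewrite sumEFin -EFinB lee_fin.
Qed.

End EsumMisc.

Section GibbsPmf.
Context {R : realType} (V : R -> R) (U : R) (S T : {fset R}).

Lemma gibbs_weight_gt0 (pi : {ffun S -> option T}) : 0 < gibbs_weight V U pi.
Proof. exact: expR_gt0. Qed.

Lemma gibbs_ge0 (pi : {ffun S -> option T}) : 0 <= gibbs V U pi.
Proof.
rewrite divr_ge0 //; first exact/ltW/gibbs_weight_gt0.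
by apply: sumr_ge0 => pi' _; exact/ltW/gibbs_weight_gt0.
Qed.

Lemma gibbs_at0_ge0 y : 0 <= gibbs_at0 V U S T y.
Proof. by apply: sumr_ge0 => pi _; exact: gibbs_ge0. Qed.

Lemma sum_gibbs : \sum_(pi : {ffun S -> option T} | partial_bijection pi) gibbs V U pi = 1.
Proof.
rewrite -mulr_suml divff // gt_eqF //.
have pb0 : partial_bijection ([ffun=> None] : {ffun S -> option T}).
  by apply/forallP => s; apply/forallP => s'; rewrite ffunE.
rewrite (bigD1 _ pb0) /= ltr_pwDl ?gibbs_weight_gt0 //.
by apply: sumr_ge0 => pi _; exact/ltW/gibbs_weight_gt0.
Qed.

Lemma sum_gibbs_at0 (L : seq (option R)) : uniq L ->
  \sum_(y <- L) gibbs_at0 V U S T y =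
  \sum_(pi : {ffun S -> option T} | partial_bijection pi && (pb_apply pi 0 \in L)) gibbs V U pi.
Proof.
move=> uL; rewrite /gibbs_at0 (exchange_big_dep (@partial_bijection R S T)) /=; last first.
  by move=> y pi _ /andP[].
rewrite big_mkcondr /=; apply: eq_bigr => pi pb.
under eq_bigl do rewrite pb /=.
case: ifP => [inL|/negbT ninL].
  rewrite -big_filter (_ : [seq _ <- _ | _] = [:: pb_apply pi 0]) ?big_seq1 //.
  by rewrite (eq_filter (a2 := pred1 (pb_apply pi 0))) ?filter_pred1_uniq // => y; rewrite /=
      eq_sym.
rewrite big1_seq // => y /andP[/eqP e yL].
by rewrite e yL in ninL.
Qed.

Lemma sum_gibbs_at0_le1 (L : seq (option R)) : uniq L ->
  \sum_(y <- L) gibbs_at0 V U S T y <= 1.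
Proof.
move=> uL; rewrite sum_gibbs_at0 // -sum_gibbs.
by apply: ler_sum_sub => [pi|pi /andP[]//]; exact: gibbs_ge0.
Qed.

Lemma pb_apply_range (pi : {ffun S -> option T}) r :
  pb_apply pi r \in None :: [seq Some t | t <- T].
Proof.
rewrite /pb_apply; case: insub => [s|] /=; last by rewrite mem_head.
case: (pi s) => [t|] /=; last by rewrite mem_head.
by rewrite inE /=; apply/mapP; exists (val t) => //; exact: valP.
Qed.

Lemma gibbs_at0_out y : ~ with_empty [set` T] y -> gibbs_at0 V U S T y = 0.
Proof.
move=> nT; rewrite /gibbs_at0 big1 // => pi /andP[_ /eqP e].
exfalso; apply: nT; have := pb_apply_range pi 0; rewrite e inE => /orP[/eqP ->|]; first by left.
by move=> /mapP[t tT ->]; right; exists t.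
Qed.

Lemma sum_gibbs_at0_range :
  \sum_(y <- None :: [seq Some t | t <- T]) gibbs_at0 V U S T y = 1.
Proof.
rewrite sum_gibbs_at0; last first.
  rewrite cons_uniq map_inj_uniq ?fset_uniq; [|by move=> ? ? []].
  by rewrite andbT; apply/negP => /mapP[].
rewrite -sum_gibbs; apply: eq_bigl => pi; by rewrite pb_apply_range andbT.
Qed.

End GibbsPmf.

Lemma cvg_sum_seq (R : realType) (I : eqType) (s : seq I) (f : nat -> I -> R) (l : I -> R) :
  (forall i, f N i @[N --> \oo] --> l i) ->
  (\sum_(i <- s) f N i) @[N --> \oo] --> \sum_(i <- s) l i.
Proof.
move=> h; elim: s => [|i s IH].
  by under eq_fun do rewrite big_nil; rewrite big_nil; exact: cvg_cst.
by under eq_fun do rewrite big_cons; rewrite big_cons; exact: cvgD.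
Qed.

(** * The limit for a fixed outcome *)

Section Limit.
Context {R : realType} (X Y : set R) (V : R -> R) (U C M : R).
Hypothesis C_ge0 : 0 <= C.
Hypothesis weight_le : forall x y, edge_weight V U x y <= C * expR (- `|x - y|).
Hypothesis good : forall T0 : nat, exists t : nat, [/\ (T0 <= t)%N,
     peak_bounded X t%:R M & peak_bounded Y t%:R M].

Let q K := gibbs_at0 V U (window K X) (window K Y).

Lemma gibbs_at0_is_cvg y : cvgn (fun N : nat => q N%:R y).
Proof.
apply/cauchy_cvgP; apply: cauchy_exP => eps eps0.
have [K0 hK] := gibbs_at0_cauchy V U C C_ge0 weight_le X Y M (eps / 2) good (divr_gt0 eps0
    (ltr0n _ 2)).
exists (q (Num.bound `|K0|)%:R y); exists (Num.bound `|K0|) => // n /= Nn.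
have K0N : K0 <= (Num.bound `|K0|)%:R.
  by apply: le_trans (ler_norm _) (ltW (archi_boundP _)).
have := hK (Num.bound `|K0|)%:R n%:R K0N (le_trans K0N _) [:: y] isT.
rewrite big_seq1 ler_nat => /(_ Nn) h; rewrite -ball_normE /=.
by apply: le_lt_trans h _; rewrite ltr_pdivrMr // ltr_pMr // ltr1n.
Qed.

Definition gibbs_limit y : R := limn (fun N : nat => q N%:R y).

Lemma gibbs_limit_cvg y : q N%:R y @[N --> \oo] --> gibbs_limit y.
Proof. exact: gibbs_at0_is_cvg. Qed.

(** The Cauchy estimate compares an integer window with a real one; letting the integer tend to
    infinity in each finite sum makes the limit along integers control all real [K]. *)
Lemma gibbs_limit_tv eps : 0 < eps -> exists K0 : R, forall K, K0 <= K ->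
  forall L : seq (option R), uniq L -> \sum_(y <- L) `|gibbs_limit y - q K y| <= eps.
Proof.
move=> eps0.
have [K0 hK] := gibbs_at0_cauchy V U C C_ge0 weight_le X Y M eps good eps0.
exists K0 => K K0K L uL.
have h : (\sum_(y <- L) `|q N%:R y - q K y|) @[N --> \oo] --> \sum_(y <- L) `|gibbs_limit y - q
    K y|.
  apply: (cvg_sum_seq _ _ _ (fun N y => `|q N%:R y - q K y|)) => y.
  by apply: cvg_norm; apply: cvgB; [exact: gibbs_limit_cvg|exact: cvg_cst].
rewrite -(cvg_lim _ h) //; apply: limr_le; first by apply/cvg_ex; eexists; exact: h.
near=> N; apply: hK => //; near: N.
exists (Num.bound `|K0|) => // n /= Nn.
apply: le_trans (ler_norm _) _; apply: le_trans (ltW (archi_boundP _)) _ => //.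
by rewrite ler_nat.
Unshelve. all: by end_near. Qed.

(** No mass escapes: the law of window [K0] has mass 1 on a finite set and is within [eps] of the
    limit there. *)
Lemma gibbs_limit_pmf : is_pmf (with_empty Y) gibbs_limit.
Proof.
have wY (K : R) y : with_empty [set` window K Y] y -> with_empty Y y.
  by case=> [->|[t tw <-]]; [left|right; exists t => //; exact: window_sub tw].
apply: is_pmf_approx.
- move=> y; apply: limr_ge; first exact: gibbs_at0_is_cvg.
  by apply: nearW => N; exact: gibbs_at0_ge0.
- move=> y nY; apply/cvg_lim => //.
  rewrite (_ : (fun N : nat => q N%:R y) = cst 0); first exact: cvg_cst.
  by apply/funext => N; apply: gibbs_at0_out => /wY.
- move=> s us.
  have h : (\sum_(y <- s) q N%:R y) @[N --> \oo] --> \sum_(y <- s) gibbs_limit y.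
    by apply: cvg_sum_seq => y; exact: gibbs_limit_cvg.
  rewrite -(cvg_lim _ h) //; apply: limr_le; first by apply/cvg_ex; eexists; exact: h.
  by apply: nearW => N; exact: sum_gibbs_at0_le1.
move=> eps eps0; have [K0 hK] := gibbs_limit_tv eps eps0.
set L := None :: [seq Some t | t <- window K0 Y].
have uL : uniq L.
  rewrite cons_uniq map_inj_uniq ?fset_uniq; [|by move=> ? ? []].
  by rewrite andbT; apply/negP => /mapP[].
exists L; split => // [y|].
  rewrite inE => /orP[/eqP ->|/mapP[t tw ->]]; first by left.
  by right; exists t => //; exact: window_sub tw.
have h := hK K0 (lexx _) L uL.
rewrite -(sum_gibbs_at0_range V U (window K0 X) (window K0 Y)) -/L lerBlDr -lerBlDl -sumrB.
apply: le_trans h; apply: ler_sum => y _; rewrite distrC; exact: ler_norm.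
Qed.

End Limit.

Section PeakBounded.
Context {R : realType}.

Lemma peak_bounded_esum (X : set R) (t M : R) :
  (\esum_(r in X) (peak t r)%:E <= M%:E)%E -> peak_bounded X t M.
Proof.
move=> h S SX; rewrite -lee_fin -sumEFin; apply: le_trans h.
by apply: sum_le_esum => [|r rS]; [exact: fset_uniq|exact: SX].
Qed.

Lemma peak_le1 t (y : R) : peak t y <= 1.
Proof. by rewrite /peak -expR0 ler_expR oppr_le0. Qed.

Context {d : measure_display} {Om : measurableType d}.
Variables (xi eta : nat -> {mfun Om >-> R}).
Variables (b : nat -> {mfun Om >-> bool}) (e : nat -> {mfun Om >-> R}).
Local Open Scope ereal_scope.

Lemma esum_range_le (f : nat -> Om -> R) t w :
  \esum_(r in range (f ^~ w)) (peak t r)%:E <= series_peak f t w.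
Proof.
have -> : range (f ^~ w) = points f (fun _ _ => true) w.
  by apply/seteqP; split=> _ [n _ <-]; exists n.
rewrite (esum_points f (fun _ _ => true) (fun r => (peak t r)%:E)) => [|r]; last first.
  by rewrite lee_fin peak_ge0.
rewrite /series_peak nneseries_esumT => [|n]; last by rewrite lee_fin peak_ge0.
by apply: le_esum => n _; case: ifP => // _; rewrite lee_fin peak_ge0.
Qed.

Lemma esum_peak1_le t (r : R) : \esum_(y in [set r]) (peak t y)%:E <= 1%:E.
Proof. by rewrite esum_set1 lee_fin ?peak_ge0 ?peak_le1. Qed.

Lemma esum_Xset_le t w :
  \esum_(r in Xset xi w) (peak t r)%:E <= 1%:E + peak_sum xi eta e t w.
Proof.
apply: (@le_trans _ _ (\esum_(r in [set 0%R] `|` range (fun n => xi n w)) (peak t r)%:E)).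
  by apply: esum_subset => _ [[|n] _ <-]; [left|right; exists n].
apply: le_trans (esum_setU_le _ _ _ _ _) _ => [r|]; first by rewrite lee_fin peak_ge0.
apply: leeD; first exact: esum_peak1_le.
apply: le_trans (esum_range_le (fun n => xi n) t w) _.
by rewrite /peak_sum -addeA leeDl // adde_ge0 ?series_peak_ge0.
Qed.

Lemma esum_Yset_le t w :
  \esum_(r in Yset xi eta b e w) (peak t r)%:E <= 1%:E + peak_sum xi eta e t w.
Proof.
have p0 r : 0 <= (peak t r)%:E :> \bar R by rewrite lee_fin peak_ge0.
apply: (@le_trans _ _ (\esum_(r in [set e 0%N w] `|`
   (range (fun n => eta n w) `|` range (fun n => xi n w + e n.+1 w)%R)) (peak t r)%:E)).
  apply: esum_subset => _ [[n _ <-]|[[|n] _ <-]].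
  - by right; left; exists n.
  - by left; rewrite /= add0r.
  - by right; right; exists n.
apply: le_trans (esum_setU_le _ _ _ _ p0) _; apply: leeD; first exact: esum_peak1_le.
apply: le_trans (esum_setU_le _ _ _ _ p0) _.
rewrite /peak_sum -addeA; apply: (@le_trans _ _ (series_peak (fun n => eta n) t w +
  series_peak (fun n w => xi n w + e n.+1 w)%R t w)); last by rewrite leeDr // series_peak_ge0.
apply: leeD; first exact: (esum_range_le (fun n => eta n)).
exact: (esum_range_le (fun n w => xi n w + e n.+1 w)%R).
Qed.

Lemma tight_good w : tight xi eta e w -> exists M : R, forall T0 : nat,
  exists t : nat, [/\ (T0 <= t)%N, peak_bounded (Xset xi w) t%:R M &
    peak_bounded (Yset xi eta b e w) t%:R M].
Proof.
move=> /limn_einf_lty[M hM]; exists (1 + M)%R => T0.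
have [t T0t tM] := hM T0; exists t; split => //; apply: peak_bounded_esum.
  by apply: le_trans (esum_Xset_le _ _) _; rewrite EFinD leeD2l.
by apply: le_trans (esum_Yset_le _ _) _; rewrite EFinD leeD2l.
Qed.

End PeakBounded.

Section EdgeWeights.
Context {R : realType} (Lam V : R -> R).
Hypothesis hLam : density_assumption Lam.
Hypothesis hV : potential_assumption V.

Lemma density_gt0 : exists2 l : R, 0 < l & forall u, u \in `[0, 1] -> l <= Lam u.
Proof.
by have [_ _ [l [L [l0 h]]]] := hLam; exists l => // u /h /andP[].
Qed.

(** Since [expR (- 2 * U) = (Lam u)^-1], the lower bound on the density makes [C] uniform in [u]. *)
Lemma edge_weight_le : exists2 C : R, 0 <= C & forall u, u \in `[0, 1] -> forall x y,
  edge_weight V (ln (Num.sqrt (Lam u))) x y <= C * expR (- `|x - y|).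
Proof.
have [l l0 hl] := density_gt0; have [C C0 hC] := potential_tail V hV.
exists (C / l); first by rewrite divr_ge0 // ltW.
move=> u u01 x y; have Lu := lt_le_trans l0 (hl u u01).
rewrite /edge_weight expRD [X in _ * X]expRN -mulr_natl expRM_natl lnK ?posrE ?sqrtr_gt0 //.
rewrite sqr_sqrtr ?(ltW Lu) // [leRHS]mulrAC; apply: ler_pM; rewrite ?expR_ge0 ?invr_ge0 ?(ltW
    Lu) //.
  apply: le_trans (hC _) _; rewrite ler_pM2l // ler_expR lerN2.
  by have := normr_ge0 (x - y); lra.
by rewrite lef_pV2 ?posrE // hl.
Qed.

Lemma measurable_log_density {d} {Om : measurableType d} (x : {mfun Om >-> R}) :
  (forall w, x w \in `[0, 1]) ->
  measurable_fun setT (fun w => ln (Num.sqrt (Lam (x w)))).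
Proof.
move=> x01; have [cL _ _] := hLam.
rewrite (_ : (fun w => _) = (fun w => ln (Lam (x w) `^ 2^-1))); last first.
  apply/funext => w; rewrite powR12_sqrt //.
  by have [l l0 hl] := density_gt0; apply: le_trans (hl _ (x01 w)); exact: ltW.
apply: measurableT_comp; first exact: measurable_ln.
apply: (measurableT_comp (measurable_powR _)).
have mL : measurable_fun (`[0, 1]%classic : set R) Lam.
  exact: subspace_continuous_measurable_fun.
have x01s : range x `<=` (`[0, 1]%classic : set R) by move=> _ [w _ <-]; exact: x01.
exact: (measurable_comp (measurable_itv _) x01s mL (measurable_funPT x)).
Qed.

End EdgeWeights.

(** * Measurability of total variation and of point masses *)

Section TVMeasurable.
Context {R : realType} {d : measure_display} {Om : measurableType d}.
Variables (z : nat -> Om -> R) (v : nat -> Om -> bool).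
Hypothesis mz : forall n, measurable_fun setT (z n).
Hypothesis mv : forall n, measurable_fun setT (v n).
Local Open Scope ereal_scope.

Lemma esum_Some (B : set R) (h : option R -> \bar R) :
  \esum_(y in Some @` B) h y = \esum_(r in B) h (Some r).
Proof. by rewrite (esum_image B Some) // => r s _ _ []. Qed.

Lemma esum_with_empty (w : Om) (h : option R -> \bar R) : (forall y, 0 <= h y) ->
  \esum_(y in with_empty (points z v w)) h y =
  h None + \esum_(n in [set: nat]) (if first z v n w then h (Some (z n w)) else 0).
Proof.
move=> h0; rewrite (esumID [set None]) => [|y _]; last exact: h0.
congr (_ + _).
  rewrite (_ : _ `&` _ = [set None]) ?esum_set1 //.
  by apply/seteqP; split => [y []//|y ->]; split => //; left.
rewrite (_ : _ `&` _ = Some @` points z v w).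
  by rewrite esum_Some (esum_points z v (fun r => h (Some r))).
apply/seteqP; split => [y [[]//]|y [r rp <-]]; split => //.
by right; exists r.
Qed.

(** All that the total variation sees of [Q]: its masses at [None] and along the enumeration,
    repetitions being discarded by [first]. *)
Definition measurable_masses (Q : Om -> option R -> R) : Prop :=
  measurable_fun setT (fun w => Q w None) /\
  forall n, measurable_fun setT (fun w => Q w (Some (z n w))).

Lemma measurable_TV (Q Q' : Om -> option R -> R) :
  measurable_masses Q -> measurable_masses Q' ->
  measurable_fun setT (fun w => TV (with_empty (points z v w)) (Q w) (Q' w)).
Proof.
move=> [mN mS] [mN' mS']; rewrite /TV; apply: measurable_funeM.
have md (f g : Om -> R) : measurable_fun setT f -> measurable_fun setT g ->
    measurable_fun setT (fun w : Om => (`|f w - g w|%R)%:E : \bar R).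
  by move=> mf mg; apply/measurable_EFinP; apply: measurableT_comp => //; exact: measurable_funB.
rewrite (_ : (fun w => _) = (fun w => (`|Q w None - Q' w None|%R)%:E +
   \esum_(n in [set: nat]) (if first z v n w then (`|Q w (Some (z n w)) - Q' w (Some (z n
       w))|%R)%:E else 0))).
  apply: emeasurable_funD; first exact: md.
  apply: measurable_esum_nat => [n w|n]; first by case: ifP; rewrite ?lee_fin.
  by apply: measurable_fun_ifT; [exact: measurable_first|exact: md|exact: measurable_cst].
apply/funext => w; rewrite (esum_with_empty w (fun y => (`|Q w y - Q' w y|%R)%:E)) //.
Qed.

Lemma measurable_borel_mass (Q : Om -> option R -> R) (B : set R) :
  measurable_masses Q -> measurable B -> (forall w, is_pmf (with_empty (points z v w)) (Q w)) ->
  measurable_fun setT (fun w => \esum_(y in B) (Q w (Some y))%:E).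
Proof.
move=> [_ mS] mB pQ.
rewrite (_ : (fun w => _) = (fun w => \esum_(n in [set: nat])
   (if first z v n w then (\1_B (z n w) * Q w (Some (z n w)))%:E else 0))).
  apply: measurable_esum_nat => [n w|n].
    by have [Q0 _ _] := pQ w; case: ifP => // _; rewrite lee_fin mulr_ge0.
  apply: measurable_fun_ifT; [exact: measurable_first| |exact: measurable_cst].
  apply/measurable_EFinP/measurable_funM => //.
  by apply: measurableT_comp => //; exact: measurable_indic.
apply/funext => w; have [Q0 Qout _] := pQ w.
rewrite -(esum_points z v (fun r => (\1_B r * Q w (Some r))%:E)) => [|r]; last first.
  by rewrite lee_fin mulr_ge0.
rewrite esum_mkcond [RHS]esum_mkcond; apply: eq_esum => r _.
rewrite indicE; have [rp|rp] := boolP (r \in points z v w).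
  by case: (r \in B); rewrite ?mul1r ?mul0r.
rewrite Qout ?if_same // => -[//|[r' r'p [rr]]].
by move/negP: rp; apply; apply/mem_set; rewrite -rr.
Qed.

End TVMeasurable.

Section PointMass.
Context {R : realType}.

Lemma isolating_radius (s : seq R) (g : R) :
  exists2 del : R, 0 < del & forall y, y \in s -> y != g -> del <= `|y - g|.
Proof.
elim: s => [|r s [del d0 h]]; first by exists 1.
have [->|rg] := eqVneq r g.
  exists del => // y; rewrite inE => /orP[/eqP ->|]; [by rewrite eqxx|exact: h].
exists (Num.min del `|r - g|); first by rewrite lt_min d0 normr_gt0 subr_eq0.
move=> y; rewrite inE => /orP[/eqP -> _|ys yg]; first by rewrite ge_min lexx orbT.
by rewrite ge_min h.
Qed.

(** A finite set [D] carries all but [eps] of the mass. A neighbourhood of [g] avoiding the other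
    points of [D] then holds at most [q g + eps]. *)
Lemma esum_near_point (q : R -> R) (g eps : R) : (forall y, 0 <= q y) ->
  (\esum_(y in [set: R]) (q y)%:E < +oo)%E -> 0 < eps ->
  exists2 del : R, 0 < del & forall B : set R, (forall y, B y -> `|y - g| < del) ->
    (\esum_(y in B) (q y)%:E <= (q g + eps)%:E)%E.
Proof.
move=> q0 qfin eps0; set tot := (\esum_(y in [set: R]) (q y)%:E)%E in qfin.
have q0' y : (0 <= (q y)%:E)%E by rewrite lee_fin; exact: q0.
have totfin : tot \is a fin_num by rewrite ge0_fin_numE // esum_ge0.
have [_ [D [finD _] <-] hD] := ub_ereal_sup_adherent eps0 totfin.
have [del d0 hdel] := isolating_radius (fset_set D) g.
exists del => // B Bdel.
have totE : tot = (\esum_(y in B) (q y)%:E + \esum_(y in ~` B) (q y)%:E)%E.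
  by rewrite /tot (esumID B) // !setTI.
have DB : (\esum_(y in D `\` [set g]) (q y)%:E <= \esum_(y in ~` B) (q y)%:E)%E.
  apply: esum_subset => y [Dy yg] By; have := Bdel y By.
  rewrite ltNge hdel //; last exact/eqP.
  by rewrite in_fset_set // mem_set.
have DE : (\sum_(y \in D) (q y)%:E <= (q g)%:E + \esum_(y in D `\` [set g]) (q y)%:E)%E.
  rewrite -esum_fset // (esumID [set g]) // leeD2r //.
  rewrite -[leRHS](@esum_set1 _ _ g (fun y => (q y)%:E)) ?lee_fin //.
  by apply: esum_subset => y [].
have Bfin : (\esum_(y in B) (q y)%:E)%E \is a fin_num.
  rewrite ge0_fin_numE ?esum_ge0 //; apply: le_lt_trans qfin; exact: esum_subset.
have Cfin : (\esum_(y in ~` B) (q y)%:E)%E \is a fin_num.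
  rewrite ge0_fin_numE ?esum_ge0 //; apply: le_lt_trans qfin; exact: esum_subset.
have : (tot - eps%:E < (q g)%:E + \esum_(y in ~` B) (q y)%:E)%E.
  by apply: lt_le_trans hD _; apply: le_trans DE _; rewrite leeD2l.
rewrite totE -(fineK Bfin) -(fineK Cfin) -!EFinD lte_fin lee_fin.
lra.
Qed.

(** Indices that code no pair of centre and radius stand for the whole line, which is harmless in an
    infimum. *)
Definition in_rat_ball (n : nat) (y : R) : bool :=
  if choice.unpickle n is Some rk then `|y - ratr (rk : rat * nat).1| < rk.2.+1%:R^-1 else true.

Lemma rat_ball_near (g del : R) : 0 < del -> exists n : nat,
  in_rat_ball n g /\ forall y, in_rat_ball n y -> `|y - g| < del.
Proof.
move=> d0; pose k := Num.bound (2 / del).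
have c0 : (0 : R) < k.+1%:R^-1 by rewrite invr_gt0.
have ck : k.+1%:R^-1 + k.+1%:R^-1 <= del.
  have : 2 / del <= k.+1%:R.
    apply: ltW; apply: lt_le_trans (archi_boundP _) _; first by rewrite divr_ge0 // ltW.
    by rewrite ler_nat.
  rewrite ler_pdivrMr // -ler_pdivrMl // => h.
  by rewrite -mulr2n -[leLHS]mulr_natr.
have /rat_in_itvoo[r] : g < g + k.+1%:R^-1 by rewrite ltrDl.
rewrite in_itv /= => /andP[gr rg]; exists (choice.pickle (r, k)).
rewrite /in_rat_ball choice.pickleK /=; split => [|y yr].
  by rewrite distrC gtr0_norm ?subr_gt0 // ltrBlDl.
apply: lt_le_trans ck; apply: le_lt_trans (ler_distD (ratr r) _ _) _.
by apply: ltrD => //; rewrite gtr0_norm ?subr_gt0 // ltrBlDl.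
Qed.

Context {d : measure_display} {Om : measurableType d}.

(* A point mass is the infimum of the masses of the rational balls containing the point. *)
Lemma measurable_point_mass (Y : Om -> set R) (Q : Om -> option R -> R) (g : Om -> R) :
  random_pmf Y Q -> measurable_fun setT g ->
  measurable_fun setT (fun w => Q w (Some (g w))).
Proof.
move=> [pmfQ _ mQ] mg; apply/measurable_EFinP.
pose B n := [set y | in_rat_ball n y].
have mB n : measurable (B n).
  rewrite /B /in_rat_ball; case: choice.unpickle => [[r k]|] /=.
    rewrite (_ : [set y | _] = ball (ratr r : R) k.+1%:R^-1); first exact: measurable_ball.
    by apply/seteqP; split => y; rewrite -ball_normE /= distrC.
  by rewrite (_ : [set y | true] = setT) //; apply/seteqP; split.
(* The value [+oo] removes from the infimum the balls that miss [g w]. *)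
pose u n w : \bar R := if in_rat_ball n (g w) then (\esum_(y in B n) (Q w (Some y))%:E)%E else
    +oo%E.
have mu n : measurable_fun setT (u n).
  apply: measurable_fun_ifT; [|exact: mQ|exact: measurable_cst].
  have := mg measurableT (B n) (mB n); rewrite setTI => mgB.
  by apply: (measurable_fun_bool true); rewrite setTI.
rewrite (_ : EFin \o _ = (fun w => einfs (u ^~ w) 0%N)); last first.
  apply/funext => w /=; have [Q0 _ Q1] := pmfQ w.
  apply/eqP; rewrite eq_le; apply/andP; split.
    apply: le_ereal_inf_tmp => _ [n _ <-]; rewrite /u; case: ifP => [gB|_]; last by rewrite leey.
    rewrite -[leLHS](@esum_set1 _ _ (g w) (fun y => (Q w (Some y))%:E)) ?lee_fin //.
    by apply: esum_subset => _ ->.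
  apply/lee_addgt0Pr => eps eps0.
  have fin : (\esum_(y in [set: R]) (Q w (Some y))%:E < +oo)%E.
    apply: (@le_lt_trans _ _ 1%E); last by rewrite ltry.
    rewrite -Q1 -(esum_Some setT (fun y => (Q w y)%:E)).
    rewrite esum_mkcond (esum_mkcond (with_empty _)); apply: le_esum => y _.
    have [yY|/negP yY] := boolP (y \in with_empty (Y w)).
      by case: ifP => _ //; rewrite lee_fin.
    have [_ Qout _] := pmfQ w.
    by rewrite Qout ?if_same // => h; apply: yY; exact/mem_set.
  have [del d0 hdel] := esum_near_point (fun y => Q w (Some y)) (g w) eps (fun y => Q0 _) fin eps0.
  have [n [gn hn]] := rat_ball_near (g w) del d0.
  apply: (@le_trans _ _ (u n w)); first by apply: ereal_inf_lbound; exists n.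
  by rewrite /u gn -EFinD; apply: hdel.
exact: measurable_fun_einfs.
Qed.

End PointMass.

(** * From almost sure limits to convergence in probability *)

Section Probability.
Context {R : realType} {d : measure_display} {Om : measurableType d}.
Variable P : probability Om R.
Local Open Scope ereal_scope.

(* The index is real, so the events are first restricted to a sequence along which the
   probability would stay bounded away from 0. *)
Lemma prob_eventually_cvg0 (E : R -> set Om) (Z : set Om) :
  (forall K, measurable (E K)) -> measurable Z -> P Z = 0 ->
  (forall w, ~ Z w -> exists K0 : R, forall K, (K0 <= K)%R -> ~ E K w) ->
  P (E K) @[K --> +oo%R] --> 0.
Proof.
move=> mE mZ PZ EZ.
have claim (del : R) : (0 < del)%R -> exists N : nat, forall K, (N%:R <= K)%R -> P (E K) <= del%:E.
  move=> d0; apply: contrapT => no.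
  have ex (N : nat) : exists K, (N%:R <= K)%R /\ del%:E < P (E K).
    apply: contrapT => h; apply: no; exists N => K NK.
    by rewrite leNgt; apply/negP => dP; apply: h; exists K.
  pose K N := projT1 (cid (ex N)).
  have KP N : (N%:R <= K N)%R /\ del%:E < P (E (K N)) := projT2 (cid (ex N)).
  (* The intersection of the [F N] is the event that infinitely many [E (K n)] occur. It lies in
     [Z], hence is null, whereas continuity from above would give it mass at least [del]. *)
  pose F N := \bigcup_(n in [set n | (N <= n)%N]) E (K n).
  have mF N : measurable (F N) by apply: bigcup_measurable.
  have mI : measurable (\bigcap_n F n) by exact: bigcapT_measurable.
  have IZ : \bigcap_n F n `<=` Z.
    move=> w wI; apply: contrapT => /EZ[K0 hK0].
    have [n /= Nn En] := wI (Num.bound `|K0|%R) I.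
    apply: (hK0 (K n)) => //; apply: le_trans (ler_norm _) _.
    apply: le_trans (ltW (archi_boundP _)) _ => //.
    by apply: le_trans (KP n).1; rewrite ler_nat.
  have PI0 : P (\bigcap_n F n) = 0.
    by apply/eqP; rewrite eq_le measure_ge0 andbT -PZ le_measure ?inE.
  have cv : P \o F @ \oo --> P (\bigcap_n F n).
    apply: nonincreasing_cvg_mu => //; first by rewrite ltey_eq fin_num_measure.
    move=> m n mn; apply/subsetPset => w [k /= nk Ek]; exists k => //=.
    exact: leq_trans nk.
  have : del%:E <= P (\bigcap_n F n).
    apply: (cvge_to_ge cv); apply: nearW => N /=.
    apply: (le_trans (ltW (KP N).2)); apply: le_measure; rewrite ?inE //.
    by move=> w Ew; exists N => /=.
  by rewrite PI0 lee_fin leNgt d0.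
apply/fine_cvgP; split; first by apply: nearW => K; exact: fin_num_measure.
apply/cvgr0Pnorm_le => del d0; have [N hN] := claim del d0.
near=> K; rewrite /= ger0_norm ?fine_ge0 // -lee_fin fineK ?fin_num_measure //.
by apply: hN; near: K; apply: nbhs_pinfty_ge; rewrite num_real.
Unshelve. all: by end_near. Qed.

Lemma TV_sym (J : choiceType) (S : set J) (Q Q' : J -> R) : TV S Q Q' = TV S Q' Q.
Proof. by rewrite /TV; congr (_ * _); apply: eq_esum => j _; rewrite distrC. Qed.

Lemma TV_triangle (J : choiceType) (S : set J) (Q Q' Q'' : J -> R) :
  TV S Q Q'' <= TV S Q Q' + TV S Q' Q''.
Proof.
rewrite /TV -ge0_muleDr ?esum_ge0 // lee_pmul2l //.
rewrite -esumD //; apply: le_esum => j _.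
by rewrite -EFinD lee_fin ler_distD.
Qed.

Lemma TV_le (J : choiceType) (S : set J) (Q Q' : J -> R) (eps : R) :
  (forall s : seq J, uniq s -> (\sum_(j <- s) `|Q j - Q' j| <= eps)%R) ->
  TV S Q Q' <= (2^-1 * eps)%:E.
Proof.
move=> h; rewrite /TV EFinM lee_pmul2l //.
by apply: esum_le_sum => s us _; rewrite sumEFin lee_fin h.
Qed.

Lemma TV_eq0 (J : choiceType) (S : set J) (Q Q' : J -> R) :
  is_pmf S Q -> is_pmf S Q' -> TV S Q Q' <= 0 -> Q = Q'.
Proof.
move=> [_ Qo _] [_ Qo' _] tv; apply/funext => j.
have [Sj|nSj] := pselect (S j); last by rewrite Qo ?Qo'.
have : \esum_(j in S) `|Q j - Q' j|%:E <= 0.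
  by move: tv; rewrite /TV pmule_rle0 // lte_fin.
have s1 (i : J) : i \in [:: j] -> S i by rewrite inE => /eqP ->.
move=> /(le_trans (sum_le_esum _ S _ [:: j] isT s1)); rewrite big_seq1 lee_fin.
by move=> h; apply/eqP; rewrite -subr_eq0 -normr_le0.
Qed.

End Probability.

(** * Assembly: enumeration of the point sets, limit law, uniqueness *)

Section Assembly.
Context {R : realType} {d : measure_display} {Om : measurableType d}.
Variables (xi eta : nat -> {mfun Om >-> R}).
Variables (b : nat -> {mfun Om >-> bool}) (e : nat -> {mfun Om >-> R}).

Definition Xall (n : nat) (w : Om) : R := Xpt xi n w.
(** Parity interleaves the two sources of points of [Y]. The resulting sequence may repeat values,
    which [first] takes care of. *)
Definition Yall (j : nat) (w : Om) : R :=
  if odd j then Xpt xi j./2 w + e j./2 w else eta j./2 w.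
Definition Yvalid (j : nat) (w : Om) : bool := odd j ==> b j./2 w.

Lemma measurable_Xall n : measurable_fun setT (Xall n).
Proof. by case: n => [|n]; [exact: measurable_cst|exact: measurable_funPT]. Qed.

Lemma measurable_Yall j : measurable_fun setT (Yall j).
Proof.
rewrite /Yall; case: (odd j) => //.
by apply: measurable_funD => //; exact: measurable_Xall.
Qed.

Lemma measurable_Yvalid j : measurable_fun setT (Yvalid j).
Proof. by rewrite /Yvalid; case: (odd j) => //=; exact: measurable_cst. Qed.

Lemma XsetE w : Xset xi w = points Xall (fun _ _ => true) w.
Proof. by apply/seteqP; split=> _ [n _ <-]; exists n. Qed.

Lemma YsetE w : Yset xi eta b e w = points Yall Yvalid w.
Proof.
apply/seteqP; split => [r [[n _ <-]|[n bn <-]]|_ [j /= vj <-]].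
- by exists n.*2; rewrite /Yvalid /Yall /= odd_double // doubleK.
- by exists n.*2.+1; rewrite /Yvalid /Yall /= odd_double //= uphalf_double.
rewrite /Yall; case: ifP => oj; last by left; exists j./2.
by right; exists j./2 => //; move: vj; rewrite /Yvalid oj.
Qed.

End Assembly.

Section LimitLaw.
Context {R : realType} {d : measure_display} {Om : measurableType d}.
Variables (Lam V : R -> R) (x : {mfun Om >-> R}).
Variables (xi eta : nat -> {mfun Om >-> R}).
Variables (b : nat -> {mfun Om >-> bool}) (e : nat -> {mfun Om >-> R}).
Hypothesis hLam : density_assumption Lam.
Hypothesis hV : potential_assumption V.
Hypothesis x01 : forall w, x w \in `[0, 1].

Let X := Xset xi.
Let Y := Yset xi eta b e.
Let QK := QK0 Lam V x X Y.
Let U w := ln (Num.sqrt (Lam (x w))).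

(* The value off [tight] is arbitrary: that event is almost sure. *)
Definition limit_law (w : Om) (y : option R) : R :=
  if `[< tight xi eta e w >] then gibbs_limit (X w) (Y w) V (U w) y
  else (y == None)%:R.

Lemma limit_law_pmf w : is_pmf (with_empty (Y w)) (limit_law w).
Proof.
rewrite /limit_law; case: asboolP => [tw|_].
  have [C C0 hC] := edge_weight_le Lam V hLam hV.
  have [M good] := tight_good xi eta b e w tw.
  exact: (gibbs_limit_pmf (X w) (Y w) V (U w) C M C0 (hC _ (x01 w)) good).
apply: is_pmf_approx => [y|y nY|s us|eps eps0].
- by [].
- by case: eqP => // yN; exfalso; apply: nY; left.
- have [sN|sN] := boolP (None \in s).
    rewrite (bigD1_seq None) //= big1 ?addr0 // => y /negbTE ->; done.
  rewrite big1_seq ?ler01 // => y /andP[_ ys].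
  by case: eqP => // yN; rewrite yN (negbTE sN) in ys.
- exists [:: None]; split => // [y|]; first by rewrite inE => /eqP ->; left.
  by rewrite big_seq1 lerBlDr lerDl ltW.
Qed.

Lemma limit_law_tv w (eps : R) : tight xi eta e w -> 0 < eps ->
  exists K0 : R, forall K, K0 <= K ->
    (TV (with_empty (Y w)) (limit_law w) (QK K w) <= (2^-1 * eps)%:E)%E.
Proof.
move=> tw eps0; have [C C0 hC] := edge_weight_le Lam V hLam hV.
have [M good] := tight_good xi eta b e w tw.
have [K0 hK] := gibbs_limit_tv (X w) (Y w) V (U w) C M C0 (hC _ (x01 w)) good eps eps0.
exists K0 => K K0K; apply: TV_le => s us.
by under eq_bigr do rewrite /limit_law asboolT //; exact: hK.
Qed.

Lemma QK0_pointsE K w y : QK K w y = gibbs_at0 V (U w)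
  (window K (points (Xall xi) (fun _ _ => true) w))
  (window K (points (Yall xi eta e) (Yvalid b) w)) y.
Proof. by rewrite -XsetE -YsetE. Qed.

Lemma measurable_QK0 K (y : Om -> option R) : (forall w, y w = None) \/
    (exists2 g : Om -> R, measurable_fun setT g & forall w, y w = Some (g w)) ->
  measurable_fun setT (fun w => QK K w (y w)).
Proof.
move=> my; under eq_fun do rewrite QK0_pointsE.
have [mV _ _ _] := hV.
apply: measurable_gibbs_at0 => //.
- exact: measurable_Xall.
- exact: measurable_Yall.
- exact: measurable_Yvalid.
- exact: measurable_log_density.
Qed.

Lemma measurable_limit_law (y : Om -> option R) : (forall w, y w = None) \/
    (exists2 g : Om -> R, measurable_fun setT g & forall w, y w = Some (g w)) ->
  measurable_fun setT (fun w => limit_law w (y w)).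
Proof.
move=> my; apply: (measurable_fun_cvg (h := fun (N : nat) w =>
  if `[< tight xi eta e w >] then QK N%:R w (y w) else (y w == None)%:R)).
  move=> N; apply: measurable_fun_ifT.
  - by apply: measurable_asbool; exact: measurable_tight.
  - exact: measurable_QK0.
  - case: my => [yN|[g mg yS]].
      rewrite (_ : (fun w => _) = cst 1); [exact: measurable_cst|].
      by apply/funext => w; rewrite yN.
    rewrite (_ : (fun w => _) = cst 0); [exact: measurable_cst|].
    by apply/funext => w; rewrite yS.
move=> w _; rewrite /limit_law; case: asboolP => [tw|_]; last exact: cvg_cst.
have [C C0 hC] := edge_weight_le Lam V hLam hV.
have [M good] := tight_good xi eta b e w tw.
exact: (gibbs_limit_cvg (X w) (Y w) V (U w) C M C0 (hC _ (x01 w)) good).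
Qed.

Lemma masses_limit_law : measurable_masses (Yall xi eta e) limit_law.
Proof.
split=> [|n]; first by apply: (measurable_limit_law (fun=> None)); left.
apply: (measurable_limit_law (fun w => Some (Yall xi eta e n w))); right.
by exists (Yall xi eta e n) => //; exact: measurable_Yall.
Qed.

Lemma masses_QK0 K : measurable_masses (Yall xi eta e) (QK K).
Proof.
split=> [|n]; first by apply: (measurable_QK0 K (fun=> None)); left.
apply: (measurable_QK0 K (fun w => Some (Yall xi eta e n w))); right.
by exists (Yall xi eta e n) => //; exact: measurable_Yall.
Qed.

(** A competing limit is known only through its masses of Borel sets; comparing it with [limit_law]
    requires its masses at random points. *)
Lemma masses_random_pmf Q : random_pmf Y Q -> measurable_masses (Yall xi eta e) Q.
Proof.
move=> rQ; have [_ mN _] := rQ; split=> // n.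
by apply: (measurable_point_mass Y Q) => //; exact: measurable_Yall.
Qed.

Lemma limit_law_random_pmf : random_pmf Y limit_law.
Proof.
split; first exact: limit_law_pmf.
  by have [] := masses_limit_law.
move=> B mB; apply: (measurable_borel_mass (Yall xi eta e) (Yvalid b)) => //.
- exact: measurable_Yall.
- exact: measurable_Yvalid.
- exact: masses_limit_law.
- by move=> w; rewrite -YsetE; exact: limit_law_pmf.
Qed.

Lemma measurable_TV_masses (Q Q' : Om -> option R -> R) (eps : R) :
  measurable_masses (Yall xi eta e) Q -> measurable_masses (Yall xi eta e) Q' ->
  measurable [set w | (eps%:E <= TV (with_empty (Y w)) (Q w) (Q' w))%E].
Proof.
move=> mQ mQ'.
have mTV : measurable_fun setT (fun w => TV (with_empty (Y w)) (Q w) (Q' w)).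
  under eq_fun do rewrite /Y YsetE.
  apply: measurable_TV => //; [exact: measurable_Yall|exact: measurable_Yvalid].
by have := emeasurable_fun_c_infty measurableT mTV eps%:E; rewrite setTI.
Qed.

Variable P : probability Om R.
Hypothesis P_tight : P (~` [set w | tight xi eta e w]) = 0%E.

Lemma limit_law_cvg : cvg_TV_in_probability P Y QK limit_law.
Proof.
move=> eps eps0.
apply: (prob_eventually_cvg0 P _ (~` [set w | tight xi eta e w])) => //.
- by move=> K; apply: measurable_TV_masses; [exact: masses_limit_law|exact: masses_QK0].
- by apply: measurableC; exact: measurable_tight.
move=> w /contrapT tw; have [K0 hK] := limit_law_tv w eps tw eps0.
exists K0 => K /hK h /= /le_trans/(_ h); rewrite lee_fin.
by rewrite leNgt gtr_pMl // invf_lt1 // ltr1n.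
Qed.

(** The event [D eps] does not depend on [K], yet by the triangle inequality its probability is at
    most a sum of two that vanish as [K] grows. *)
Lemma limit_law_unique (Q : Om -> option R -> R) : random_pmf Y Q ->
  cvg_TV_in_probability P Y QK Q -> {ae P, forall w, Q w = limit_law w}.
Proof.
move=> rQ cQ; have mQ := masses_random_pmf Q rQ; have mL := masses_limit_law.
pose D eps := [set w | (eps%:E <= TV (with_empty (Y w)) (Q w) (limit_law w))%E].
have mD eps : measurable (D eps) by exact: measurable_TV_masses.
have D0 eps : 0 < eps -> P (D eps) = 0%E.
  move=> eps0; have e20 : 0 < eps / 2 by rewrite divr_gt0.
  pose E1 K := [set w | ((eps / 2)%:E <= TV (with_empty (Y w)) (Q w) (QK K w))%E].
  pose E2 K := [set w | ((eps / 2)%:E <= TV (with_empty (Y w)) (limit_law w) (QK K w))%E].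
  have mE1 K : measurable (E1 K) by apply: measurable_TV_masses => //; exact: masses_QK0.
  have mE2 K : measurable (E2 K) by apply: measurable_TV_masses => //; exact: masses_QK0.
  have cv : (P (E1 K) + P (E2 K))%E @[K --> +oo] --> (0 + 0)%E.
    by apply: cvgeD => //; [exact: cQ|exact: limit_law_cvg].
  apply/eqP; rewrite eq_le measure_ge0 andbT -[leRHS]adde0.
  apply: (cvge_to_ge cv); apply: nearW => K.
  apply: le_trans (measureU2 P (mE1 K) (mE2 K)); apply: le_measure; rewrite ?inE //.
    exact: measurableU.
  move=> w Dw; have [|h1] := leP (eps / 2)%:E (TV (with_empty (Y w)) (Q w) (QK K w)).
    by left.
  right; rewrite /E2 /= leNgt; apply/negP => h2.
  have := le_trans Dw (TV_triangle _ _ _ (QK K w) _); rewrite [X in (_ + X)%E]TV_sym.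
  rewrite leNgt => /negP; apply; rewrite [eps in eps%:E](splitr eps) EFinD.
  exact: lteD.
have neg : P.-negligible (\bigcup_n D n.+1%:R^-1).
  by apply: negligible_bigcup => n; exists (D n.+1%:R^-1); split => //; exact: D0.
apply: negligibleS neg => w /= nQ; apply: contrapT => nD; apply: nQ.
have [pQ _ _] := rQ.
apply: (TV_eq0 _ (with_empty (Y w))); [exact: pQ|exact: limit_law_pmf|].
apply/lee_addgt0Pr => eps eps0; rewrite add0e.
rewrite leNgt; apply/negP => h; apply: nD.
exists (Num.bound eps^-1) => //; rewrite /D /=; apply: le_trans (ltW h).
rewrite lee_fin -[leRHS]invrK lef_pV2 ?posrE ?invr_gt0 //.
apply: (le_trans (ltW (archi_boundP _))); first by rewrite invr_ge0 ltW.
by rewrite ler_nat.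
Qed.

End LimitLaw.

Theorem proposition2p8 (R : realType) (p : R) (hp : 0 < p < 1)
    (Lam V : R -> R)
    (hLam : density_assumption Lam) (hV : potential_assumption V)
    (d : measure_display) (Om : measurableType d) (P : probability Om R)
    (x : {mfun Om >-> R}) (xi eta : nat -> {mfun Om >-> R})
    (b : nat -> {mfun Om >-> bool}) (e : nat -> {mfun Om >-> R})
    (hP : is_construction p Lam V x xi eta b e P) :
  let X := Xset xi in
  let Y := Yset xi eta b e in
  let QK := QK0 Lam V x X Y in
  exists Q : Om -> option R -> R,
    [/\ random_pmf Y Q,
        cvg_TV_in_probability P Y QK Q &
        forall Q' : Om -> option R -> R,
          random_pmf Y Q' -> cvg_TV_in_probability P Y QK Q' ->
          {ae P, forall w, Q' w = Q w}].
Proof.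
move=> X Y QK; have [x01 xinj einj [kappa [PE _ hk]]] := hP.
(* Tightness has probability 1 under each conditional law [kappa u], and [P] is the mixture of these
   with density [Lam]. *)
have P_tight : P (~` [set w | tight xi eta e w]) = 0%E.
  rewrite PE; last by apply: measurableC; exact: measurable_tight.
  apply: integral0_eq => u u01.
  have [l l0 hl] := density_gt0 Lam hLam.
  have u01' : u \in `[0, 1] by exact: u01.
  have Lu : 0 <= Lam u by apply: le_trans (hl u u01'); exact: ltW.
  by rewrite (tight_full p V xi eta b e _ (Lam u) hp Lu hV xinj einj (hk u u01')) mul0e.
exists (limit_law Lam V x xi eta b e); split.
- exact: limit_law_random_pmf.
- exact: limit_law_cvg.
- by move=> Q' rQ' cQ'; exact: limit_law_unique.
Qed.
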